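(* Let $(S,\|\cdot\|)$ be a complete $RN$ module over $K$ with base $(\Omega,\mathcal F,P)$, and let $\{T(t):t\geq0\}$ be a $C_{0}$--semigroup on $S$ with infinitesimal generator $(A,D(A))$. For $x\in D(A)$ let $f_x:[0,+\infty)\to S$, $f_x(t)=T(t)x$. Then $\{T(t):t\geq0\}$ is a.s. bounded if and only if, for every $x\in D(A)$ and every finite real closed interval $[0,r]$, $f_x$ is $L^{0}$-Lipschitz on $[0,r]$ (i.e. there is $\xi\in L^0_+(\mathcal F)$ with $\|f_x(t_1)-f_x(t_2)\|\le\xi|t_1-t_2|$ for all $t_1,t_2\in[0,r]$).
   Context: $(\Omega,\mathcal F,P)$ is a probability space; $L^{0}(\mathcal F,K)$ ($K=R$ or $C$) is the algebra of equivalence classes of $K$-valued $\mathcal F$-measurable random variables, ordered a.s.; $L^{0}_{+}(\mathcal F)=\{\xi\in L^0(\mathcal F,R):\xi\ge 0\}$. Suprema are taken in the complete lattice of extended random variables. An $RN$ module over $K$ with base $(\Omega,\mathcal F,P)$ is a left $L^0(\mathcal F,K)$-module $S$ with a map $\|\cdot\|:S\to L^0_+(\mathcal F)$ such that $\|\xi x\|=|\xi|\|x\|$, $\|x+y\|\le\|x\|+\|y\|$, $\|x\|=0\Rightarrow x=0$; it carries the $(\varepsilon,\lambda)$-topology, in which $x_n\to x$ iff $\|x_n-x\|\to0$ in probability; completeness refers to this topology. $B(S)$ is the set of continuous module homomorphisms $S\to S$, with $\|T\|=\bigwedge\{\xi\in L^0_+(\mathcal F):\|Tx\|\le\xi\|x\|\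 \forall x\}$. A $C_0$--semigroup is $\{T(t):t\ge0\}\subset B(S)$ with $T(0)=I$, $T(s)T(t)=T(s+t)$, $\lim_{t\downarrow0}T(t)x=x$ for all $x$. It is a.s. bounded if there is a real $L>0$ with $\bigvee_{t\in[0,L]}\|T(t)\|\in L^0_+(\mathcal F)$. Its infinitesimal generator is $Ax=\lim_{t\downarrow0}\frac{T(t)x-x}{t}$ on $D(A)=\{x:\text{the limit exists}\}$. *)

(* Defs.v *)
From HB Require Import structures.
From mathcomp Require Import all_boot all_order all_algebra.
From mathcomp Require Import all_classical all_reals all_analysis measurable_realfun.
From mathcomp Require Import complex.
Import Order.TTheory GRing.Theory Num.Theory.

Set Implicit Arguments.
Unset Strict Implicit.
Unset Printing Implicit Defensive.

Local Open Scope classical_set_scope.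
Local Open Scope ring_scope.

(* Random variables.  An element of L^0(F,K) is represented by one of its    *)
(* (F-measurable) representatives omega |-> xi omega; all (in)equalities     *)
(* between elements of L^0 are understood almost surely.  Both scalar fields *)
(* K = R and K = C are handled uniformly: K-valued random variables are      *)
(* R[i]-valued functions with measurable real and imaginary parts, and for   *)
(* K = R (isC = false) the imaginary part is required to vanish, i.e. the    *)
(* representative is real valued.                                            *)
Section RandomVariables.
Context {d : measure_display} {T : measurableType d} {R : realType}.
Variable P : probability T R.

Definition L0K (isC : bool) (xi : T -> R[i]) : Prop :=
  measurable_fun setT (fun w => complex.Re (xi w)) /\
  measurable_fun setT (fun w => complex.Im (xi w)) /\
  (if isC then True else forall w, complex.Im (xi w) = 0).

Definition L0plus (xi : T -> R) : Prop :=
  measurable_fun setT xi /\ {ae P, forall w, 0 <= xi w}.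

Definition cstK (r : R) : T -> R[i] := fun _ => Complex r 0.

Definition is_esssup (A : set (T -> \bar R)) (eta : T -> \bar R) : Prop :=
  measurable_fun setT eta /\
  (forall zeta, A zeta -> {ae P, forall w, (zeta w <= eta w)%E}) /\
  (forall eta', measurable_fun setT eta' ->
     (forall zeta, A zeta -> {ae P, forall w, (zeta w <= eta' w)%E}) ->
     {ae P, forall w, (eta w <= eta' w)%E}).

Definition is_essinf (A : set (T -> \bar R)) (eta : T -> \bar R) : Prop :=
  measurable_fun setT eta /\
  (forall zeta, A zeta -> {ae P, forall w, (eta w <= zeta w)%E}) /\
  (forall eta', measurable_fun setT eta' ->
     (forall zeta, A zeta -> {ae P, forall w, (eta' w <= zeta w)%E}) ->
     {ae P, forall w, (eta' w <= eta w)%E}).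

End RandomVariables.

Record RNModule {d : measure_display} {T : measurableType d} {R : realType}
    (P : probability T R) (isC : bool) (S : zmodType) := {
  rn_scale : (T -> R[i]) -> S -> S ;
  rn_norm : S -> T -> R ;
  (* the action is well defined on equivalence classes *)
  rn_scale_ae : forall xi eta x, L0K isC xi -> L0K isC eta ->
    {ae P, forall w, xi w = eta w} -> rn_scale xi x = rn_scale eta x ;
  rn_scaleDr : forall xi x y, L0K isC xi ->
    rn_scale xi (x + y) = rn_scale xi x + rn_scale xi y ;
  rn_scaleDl : forall xi eta x, L0K isC xi -> L0K isC eta ->
    rn_scale (fun w => xi w + eta w) x = rn_scale xi x + rn_scale eta x ;
  rn_scaleA : forall xi eta x, L0K isC xi -> L0K isC eta ->
    rn_scale (fun w => xi w * eta w) x = rn_scale xi (rn_scale eta x) ;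
  rn_scale1 : forall x, rn_scale (fun _ => 1) x = x ;
  rn_norm_L0 : forall x, L0plus P (rn_norm x) ;
  rn_normZ : forall xi x, L0K isC xi ->
    {ae P, forall w, rn_norm (rn_scale xi x) w = Normc.normc (xi w) * rn_norm x w} ;
  rn_normD : forall x y,
    {ae P, forall w, rn_norm (x + y) w <= rn_norm x w + rn_norm y w} ;
  rn_norm_eq0 : forall x, {ae P, forall w, rn_norm x w = 0} -> x = 0
}.

Section RNTheory.
Context {d : measure_display} {T : measurableType d} {R : realType}.
Variables (P : probability T R) (isC : bool) (S : zmodType).
Variable M : RNModule P isC S.

Local Notation nrm := (rn_norm M).
Local Notation scl := (rn_scale M).

(* P{ ||x|| >= eps } : used for the (eps,lambda)-neighbourhoods
   N(y; eps, lambda) = { x : P{ ||x - y|| < eps } > 1 - lambda } *)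
Definition tailP (x : S) (eps : R) : \bar R := P [set w | eps <= nrm x w].

Definition rn_cvg {I : Type} (F : set_system I) (g : I -> S) (x : S) : Prop :=
  forall eps lam : R, 0 < eps -> 0 < lam ->
    \forall i \near F, (tailP (g i - x) eps < lam%:E)%E.

Definition rn_cauchy (u : nat -> S) : Prop :=
  forall eps lam : R, 0 < eps -> 0 < lam ->
    exists N : nat, forall m n : nat, (N <= m)%N -> (N <= n)%N ->
      (tailP (u m - u n) eps < lam%:E)%E.

Definition rn_complete : Prop :=
  forall u : nat -> S, rn_cauchy u -> exists x, rn_cvg \oo u x.

Definition rn_bounded_op (A : S -> S) : Prop :=
  (forall x y, A (x + y) = A x + A y) /\
  (forall xi x, L0K isC xi -> A (scl xi x) = scl xi (A x)) /\
  (forall x (eps lam : R), 0 < eps -> 0 < lam ->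
     exists delta mu : R, 0 < delta /\ 0 < mu /\
       forall y, (tailP (y - x) delta < mu%:E)%E ->
                 (tailP (A y - A x) eps < lam%:E)%E).

Definition opnorm_bounds (A : S -> S) : set (T -> \bar R) :=
  [set zeta | exists xi : T -> R, L0plus P xi /\
     (forall x, {ae P, forall w, nrm (A x) w <= xi w * nrm x w}) /\
     zeta = (fun w => (xi w)%:E)].

Definition is_opnorm (A : S -> S) (eta : T -> \bar R) : Prop :=
  is_essinf P (opnorm_bounds A) eta.

(* C_0-semigroup {Tt : t >= 0} (Tt is only used for t >= 0) *)
Definition C0_semigroup (Tt : R -> S -> S) : Prop :=
  (forall t, 0 <= t -> rn_bounded_op (Tt t)) /\
  (forall x, Tt 0 x = x) /\
  (forall s t x, 0 <= s -> 0 <= t -> Tt s (Tt t x) = Tt (s + t) x) /\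
  (forall x, rn_cvg (0:R)^'+ (fun t => Tt t x) x).

Definition as_bounded (Tt : R -> S -> S) : Prop :=
  exists L : R, 0 < L /\
    exists (N : R -> T -> \bar R) (eta : T -> \bar R),
      (forall t, 0 <= t <= L -> is_opnorm (Tt t) (N t)) /\
      is_esssup P [set N t | t in `[0, L]] eta /\
      {ae P, forall w, (0 <= eta w)%E /\ eta w \is a fin_num}.

Definition generator (Tt : R -> S -> S) (x y : S) : Prop :=
  rn_cvg (0:R)^'+ (fun t => scl (cstK t^-1) (Tt t x - x)) y.

Definition gen_domain (Tt : R -> S -> S) (x : S) : Prop :=
  exists y, generator Tt x y.

Definition L0_lipschitz_on (f : R -> S) (r : R) : Prop :=
  exists xi : T -> R, L0plus P xi /\
    forall t1 t2, 0 <= t1 <= r -> 0 <= t2 <= r ->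
      {ae P, forall w, nrm (f t1 - f t2) w <= xi w * `|t1 - t2|}.

End RNTheory.

(* Main.v *)
(* Convergence in probability is measured by [rho f := E (min 1 |f|)].

   If the semigroup is a.s. bounded and [x \in D(A)], then
   [T(t) x - x = \sum_(k < n) T(k t / n) (T(t / n) x - x)] has norm at most
   [xi * t * ||(T(t / n) x - x) / (t / n)||], which tends to [xi * t * ||A x||].

   Conversely, a gliding hump argument shows that the [T(t)], [t] in a compact
   interval, are equicontinuous, i.e. the norms [||T(t)||] are bounded in
   probability. Hille's argument for subadditive functions then bounds them by
   a single random variable on intervals away from [0]. Suppose they are not so
   bounded near [0]. Vectors [T(a) z], [a > 0], have bounded orbits, and after
   multiplication by a random scalar one finds vectors whose orbits on [0, 2]
   are arbitrarily small in [L^1], uniformly in time, but have a supremum that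
   is large with a fixed probability. A second gliding hump sums them to a
   vector [y] whose orbit is continuous in [L^1] but not a.s. bounded. Then
   [x := \int_0^1 T(s) y ds] exists as a limit of Riemann sums, lies in [D(A)]
   and satisfies [A x = T(1) y - y]; if the orbit of [x] is Lipschitz, the
   orbit of [T(1) y - y] is bounded, hence so is that of [y]: a contradiction. *)

Require Import Defs.
From HB Require Import structures.
From mathcomp Require Import all_boot all_order all_algebra.
From mathcomp Require Import all_classical all_reals all_analysis measurable_realfun.
From mathcomp Require Import complex.
From mathcomp Require Import lra ring.
Import Order.TTheory GRing.Theory Num.Theory.
Import numFieldNormedType.Exports.
Set Implicit Arguments.
Unset Strict Implicit.
Unset Printing Implicit Defensive.
Local Open Scope classical_set_scope.
Local Open Scope ring_scope.

(** * The metric of convergence in probability *)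

Section Rho.
Context {d : measure_display} {T : measurableType d} {R : realType}.
Variable P : probability T R.
Implicit Types f g h k : T -> R.

(** [L^0] is not locally convex: [rho] is subadditive but not homogeneous, averages of vectors with
    small [rho] can be large, and continuity in probability alone does not make Riemann sums
    converge. Integrals are therefore controlled in mean through [L1le], which is homogeneous and
    stable under averaging, and the humps must be small in mean at all times of [[0, 2]], not merely
    small as vectors. Smallness in mean is obtained from smallness of [rho] for orbits bounded by a
    constant, which is why random scalars truncate the vectors.

    Suprema over uncountably many times or unit vectors are the other obstacle, as each a.s.
    inequality has its own null set. Times are taken in finite dyadic grids, and right continuity
    recovers the others. Unit vectors can be glued along events, so their images are directed
    upwards and the random norm is the limit of an increasing sequence of them; a bound in
    probability uniform over the unit ball thus passes to the norm. Bounded in probability means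
    here that some [c > 0] makes all [rho (c * f)] small. *)

Definition clip f : T -> R := fun w => Num.min 1 `|f w|.

Definition rho f : R := fine (\int[P]_w (clip f w)%:E)%E.

Lemma measurable_abs f : measurable_fun setT f ->
  measurable_fun setT (fun w => `|f w|).
Proof. by move=> mf; apply: (measurableT_comp (@normr_measurable R setT)). Qed.

Lemma measurable_clip f : measurable_fun setT f -> measurable_fun setT (clip f).
Proof. by move=> mf; apply: measurable_minr => //; apply: measurable_abs. Qed.

Lemma clip_ge0 f w : 0 <= clip f w.
Proof. by rewrite /clip le_min ler01 normr_ge0. Qed.

Lemma clip_le1 f w : clip f w <= 1.
Proof. by rewrite /clip ge_min lexx. Qed.

Lemma clip_le f w : clip f w <= `|f w|.
Proof. by rewrite /clip ge_min lexx orbT. Qed.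

Lemma int_clip_le1 f : measurable_fun setT f ->
  (\int[P]_w (clip f w)%:E <= 1)%E.
Proof.
move=> mf; apply: (@le_trans _ _ (\int[P]_w (cst 1 w))%E); last first.
  by rewrite integral_cst //= probability_setT mule1.
apply: ge0_le_integral => //.
- by move=> w _; rewrite lee_fin clip_ge0.
- by apply/measurable_EFinP; apply: measurable_clip.
- by move=> w _; rewrite lee_fin clip_le1.
Qed.

Lemma rhoE f : measurable_fun setT f ->
  (\int[P]_w (clip f w)%:E)%E = (rho f)%:E.
Proof.
move=> mf; rewrite /rho fineK // fin_real //; apply/andP; split.
  apply: lt_le_trans (ltNyr 0) _; apply: integral_ge0 => w _.
  by rewrite lee_fin clip_ge0.
exact: le_lt_trans (int_clip_le1 mf) (ltry 1).
Qed.

Lemma rho_ge0 f : 0 <= rho f.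
Proof.
by apply: fine_ge0; apply: integral_ge0 => w _; rewrite lee_fin clip_ge0.
Qed.

Lemma rho_le1 f : measurable_fun setT f -> rho f <= 1.
Proof. by move=> mf; rewrite -lee_fin -rhoE //; apply: int_clip_le1. Qed.

(** The second term on the left is for [ms_opnorm], where two expectations have to fit below a
    single one. Clipping makes every term integrable, so measurability is all that is asked of the
    functions. *)
Lemma rho_lin (a b c e : R) f g h k :
  0 <= a -> 0 <= b -> 0 <= c -> 0 <= e ->
  measurable_fun setT f -> measurable_fun setT g ->
  measurable_fun setT h -> measurable_fun setT k ->
  {ae P, forall w, a * clip f w + b * clip g w <= c * clip h w + e * clip k w} ->
  a * rho f + b * rho g <= c * rho h + e * rho k.
Proof.
move=> a0 b0 c0 e0 mf mg mh mk H.
have comb (x y : R) u v : 0 <= x -> 0 <= y -> measurable_fun setT u ->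
    measurable_fun setT v ->
    (\int[P]_w (x * clip u w + y * clip v w)%:E)%E = (x * rho u + y * rho v)%:E.
  move=> x0 y0 mu mv.
  under eq_integral do rewrite EFinD !EFinM.
  rewrite ge0_integralD //; last 4 first.
  - by move=> w _; rewrite -EFinM lee_fin mulr_ge0 // clip_ge0.
  - apply: measurable_funeM; apply/measurable_EFinP; exact: measurable_clip.
  - by move=> w _; rewrite -EFinM lee_fin mulr_ge0 // clip_ge0.
  - apply: measurable_funeM; apply/measurable_EFinP; exact: measurable_clip.
  rewrite !ge0_integralZl //.
  - by rewrite !rhoE.
  - apply/measurable_EFinP; exact: measurable_clip.
  - by move=> w _; rewrite lee_fin clip_ge0.
  - apply/measurable_EFinP; exact: measurable_clip.
  - by move=> w _; rewrite lee_fin clip_ge0.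
rewrite -lee_fin -!comb //.
apply: ae_ge0_le_integral => //.
- by move=> w _; rewrite lee_fin addr_ge0 // mulr_ge0 // clip_ge0.
- apply/measurable_EFinP; apply: measurable_funD;
    apply: measurable_funM => //; exact: measurable_clip.
- by move=> w _; rewrite lee_fin addr_ge0 // mulr_ge0 // clip_ge0.
- apply/measurable_EFinP; apply: measurable_funD;
    apply: measurable_funM => //; exact: measurable_clip.
- by apply: filterS H => w H _; rewrite lee_fin.
Qed.

Lemma clip_add (x y z : R) : `|x| <= `|y| + `|z| ->
  Num.min 1 `|x| <= Num.min 1 `|y| + Num.min 1 `|z|.
Proof.
have := normr_ge0 x; have := normr_ge0 y; have := normr_ge0 z.
set a := `|x|; set b := `|y|; set c := `|z|.
by case: (leP 1 a); case: (leP 1 b); case: (leP 1 c); lra.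
Qed.

Lemma clip_mono (x y : R) : `|x| <= `|y| -> Num.min 1 `|x| <= Num.min 1 `|y|.
Proof.
set a := `|x|; set b := `|y|.
by case: (leP 1 a); case: (leP 1 b); lra.
Qed.

Lemma rho_scaled (a b : R) f g : 0 <= a -> 0 <= b ->
  measurable_fun setT f -> measurable_fun setT g ->
  {ae P, forall w, a * clip f w <= b * clip g w} -> a * rho f <= b * rho g.
Proof.
move=> a0 b0 mf mg H.
have := @rho_lin a 0 b 0 f f g g a0 (lexx 0) b0 (lexx 0) mf mf mg mg.
rewrite !mul0r !addr0; apply; apply: filterS H => w.
by rewrite !mul0r !addr0.
Qed.

Lemma rho_le f g : measurable_fun setT f -> measurable_fun setT g ->
  {ae P, forall w, `|f w| <= `|g w|} -> rho f <= rho g.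
Proof.
move=> mf mg H; have := @rho_scaled 1 1 f g ler01 ler01 mf mg.
rewrite !mul1r; apply; apply: filterS H => w H.
by rewrite !mul1r; apply: clip_mono.
Qed.

Lemma rho_add f g h : measurable_fun setT f -> measurable_fun setT g ->
  measurable_fun setT h ->
  {ae P, forall w, `|f w| <= `|g w| + `|h w|} -> rho f <= rho g + rho h.
Proof.
move=> mf mg mh H.
have := @rho_lin 1 0 1 1 f f g h ler01 (lexx 0) ler01 ler01 mf mf mg mh.
rewrite !mul1r mul0r addr0; apply; apply: filterS H => w H.
by rewrite !mul1r mul0r addr0; apply: clip_add.
Qed.

Lemma rho_cst (c : R) : 0 <= c <= 1 -> rho (fun _ => c) = c.
Proof.
move=> /andP[c0 c1]; rewrite /rho.
under eq_integral do rewrite /clip ger0_norm // min_r //.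
by rewrite integral_cst //= probability_setT mule1.
Qed.

Lemma rho_bound (c : R) f : 0 <= c -> measurable_fun setT f ->
  {ae P, forall w, `|f w| <= c} -> rho f <= c.
Proof.
move=> c0 mf H; case: (leP c 1) => c1; last first.
  exact: le_trans (rho_le1 mf) (ltW c1).
rewrite -[leRHS]rho_cst ?c0 //; apply: rho_le => //.
by apply: filterS H => w fw; rewrite [leRHS]ger0_norm.
Qed.

Lemma rho_eq0 f : measurable_fun setT f -> rho f <= 0 ->
  {ae P, forall w, f w = 0}.
Proof.
move=> mf r0.
have {r0}r0 : rho f = 0 by apply/eqP; rewrite eq_le r0 rho_ge0.
have mc : measurable_fun setT (EFin \o clip f).
  by apply/measurable_EFinP; apply: measurable_clip.
have /ae_eq_integral_abs : (\int[P]_w `|(EFin \o clip f) w|)%E = 0%E.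
  transitivity (rho f)%:E; last by rewrite r0.
  rewrite -rhoE //; by apply: eq_integral => w _; rewrite /= ger0_norm // clip_ge0.
move=> /(_ measurableT mc); apply: filterS => w /(_ I) /= [].
rewrite /clip; case: (leP 1 `|f w|) => _ h; last exact/normr0_eq0.
by move/eqP: h; rewrite oner_eq0.
Qed.

Lemma rho_mulr (c : R) f : measurable_fun setT f ->
  rho (fun w => c * f w) <= Num.max 1 `|c| * rho f.
Proof.
move=> mf; have mcf : measurable_fun setT (fun w => c * f w).
  exact: measurable_funM.
rewrite -[leLHS]mul1r; apply: rho_scaled => //.
apply: aeW => w; rewrite mul1r /clip normrM.
have := normr_ge0 c; have := normr_ge0 (f w).
set a := `|c|; set b := `|f w|.
case: (leP 1 a) => ha; case: (leP 1 b) => hb; case: (leP 1 (a * b)) => hc; nra.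
Qed.

Lemma rho_mul_clip (c : R) f : 0 <= c -> measurable_fun setT f ->
  rho (fun w => c * clip f w) <= c * rho f.
Proof.
move=> c0 mf; rewrite -[leLHS]mul1r; apply: rho_scaled => //.
  by apply: measurable_funM => //; apply: measurable_clip.
apply: aeW => w; rewrite mul1r.
apply: le_trans (clip_le _ _) _.
by rewrite normrM !ger0_norm // clip_ge0.
Qed.

(** Clipping provides the dominating constant [1] for dominated convergence. *)
Lemma rho_cvg0 (f : nat -> T -> R) : (forall n, measurable_fun setT (f n)) ->
  {ae P, forall w, f n w @[n --> \oo] --> (0 : R)} ->
  rho (f n) @[n --> \oo] --> (0 : R).
Proof.
move=> mf H.
have [] := @dominated_convergence _ _ _ P setT measurableT
  (fun n w => (clip (f n) w)%:E) (cst 0%E) (cst 1%E).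
- by move=> n; apply/measurable_EFinP; apply: measurable_clip.
- exact: measurable_cst.
- apply: filterS H => w H _; apply/(@fine_cvgP R nat \oo _ (fun n => (clip (f n) w)%:E) 0).
  split; first exact: nearW.
  apply/cvgrPdist_lt => e e0; near=> n.
  rewrite sub0r normrN ger0_norm ?clip_ge0 //; apply: le_lt_trans (clip_le _ _) _.
  by near: n; move/cvgr_dist_lt: H => /(_ _ e0); apply: filterS => n; rewrite sub0r normrN.
- apply/integrableP; split; first exact: measurable_cst.
  by under eq_integral do rewrite abse1; rewrite integral_cst //= probability_setT mule1 ltry.
- by apply: aeW => w n _; rewrite /= lee_fin ger0_norm ?clip_le1 ?clip_ge0.
move=> _ _; rewrite integral0 => /fine_cvgP[_].
by apply: cvg_trans; apply: near_eq_cvg; apply: nearW => n.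
Unshelve. all: by end_near. Qed.

(** A single random variable is bounded in probability, because [f / n] tends to [0] a.s. All
    [c' <= c] are covered so that [c'] can be, for instance, a power of one half. *)
Lemma rho_small f (e : R) : measurable_fun setT f -> 0 < e ->
  exists2 c, 0 < c <= 1 & forall c', 0 <= c' <= c -> rho (fun w => c' * f w) < e.
Proof.
move=> mf e0.
have mcf c : measurable_fun setT (fun w => c * f w) by exact: measurable_funM.
have /cvgrPdist_lt /(_ _ e0) [N _ HN] :
    rho (fun w => n.+1%:R^-1 * f w) @[n --> \oo] --> (0 : R).
  apply: rho_cvg0 => //; apply: aeW => w.
  rewrite -[X in _ --> X](mul0r (f w)); apply: cvgM; last exact: cvg_cst.
  exact: cvg_harmonic.
exists N.+1%:R^-1; first by rewrite invr_gt0 ltr0n /= invf_le1 ?ltr0n // ler1n.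
move=> c /andP[c0 cN]; apply: le_lt_trans (HN N (leqnn N)).
rewrite sub0r normrN ger0_norm ?rho_ge0 //; apply: rho_le => //.
apply: aeW => w; rewrite !normrM ler_wpM2r //.
by rewrite !ger0_norm ?invr_ge0.
Qed.

Lemma measurable_superlevel (e : R) f : measurable_fun setT f ->
  measurable [set w | e <= f w].
Proof.
move=> mf; rewrite -[X in measurable X]setTI.
have := @measurable_fun_ler _ T R setT (cst e) f (measurable_cst _) mf.
move=> /(_ measurableT [set true]); exact.
Qed.

Lemma prob_rho (A : set T) : measurable A -> P A = (rho \1_A)%:E.
Proof.
move=> mA; rewrite -rhoE; last exact: measurable_indic.
rewrite -[X in P X]setIT -integral_indic //.
apply: eq_integral => w _; congr EFin; rewrite /clip indicE.
by case: (_ \in _); rewrite ?normr1 ?normr0 ?minxx ?min_r.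
Qed.

(** On the event, [clip f] is at least [min 1 e]; the factor is the inverse of that number. *)
Lemma markov_rho f (e : R) : 0 < e -> measurable_fun setT f ->
  (P [set w | (e <= f w)%R] <= (Num.max 1 e^-1 * rho f)%:E)%E.
Proof.
move=> e0 mf; have mA := measurable_superlevel e mf.
have mi := @measurable_indic _ T R setT _ mA.
rewrite (prob_rho mA).
rewrite lee_fin -[leLHS]mul1r; apply: rho_scaled => //.
  by rewrite le_max ler01.
apply: aeW => w; rewrite mul1r /clip indicE; case: (boolP (w \in _)) => [/set_mem /= hw|_];
  last by rewrite normr0 min_r // mulr_ge0 ?le_max ?ler01 // le_min ler01 normr_ge0.
rewrite normr1 minxx.
have ha : e <= `|f w| by apply: le_trans hw (ler_norm _).
have ei : e^-1 * e = 1 by rewrite mulVf // gt_eqF.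
have e'0 : 0 < e^-1 by rewrite invr_gt0.
case: (leP 1 `|f w|) => h1; case: (leP 1 e^-1) => h2; nra.
Qed.

Lemma rho_le_tail f (e : R) : 0 < e -> measurable_fun setT f ->
  {ae P, forall w, 0 <= f w} -> ((rho f)%:E <= e%:E + P [set w | (e <= f w)%R])%E.
Proof.
move=> e0 mf f0; have mA := measurable_superlevel e mf.
have mi := @measurable_indic _ T R setT _ mA.
rewrite (prob_rho mA).
rewrite -EFinD lee_fin.
apply: (@le_trans _ _ (rho (cst e) + rho \1_[set w | e <= f w])); last first.
  by rewrite lerD2r; apply: rho_bound => //; [exact: ltW|apply: aeW => w; rewrite gtr0_norm].
have := @rho_lin 1 0 1 1 f f (cst e) \1_[set w | e <= f w]
   ler01 (lexx 0) ler01 ler01 mf mf.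
rewrite !mul1r mul0r addr0; apply => //.
apply: filterS f0 => w fw; rewrite !mul1r mul0r addr0 /clip indicE.
case: (boolP (w \in _)) => [_|hw].
  by rewrite normr1 minxx (@le_trans _ _ 1) ?ge_min ?lexx // lerDr le_min ler01 normr_ge0.
rewrite normr0 (@min_r _ _ 1 0) // addr0; apply: clip_mono.
have /ltW : f w < e by rewrite ltNge; apply: contra hw => h; exact: mem_set.
by rewrite (ger0_norm fw) (gtr0_norm e0).
Qed.

(** The positive part of [f - g] is dominated by every [|h n|], so its [rho] vanishes. This is how
    a.s. inequalities pass to limits in probability without extracting subsequences. *)
Lemma le_of_rho_small f g (h : nat -> T -> R) :
  measurable_fun setT f -> measurable_fun setT g ->
  (forall n, measurable_fun setT (h n)) ->
  (forall e, 0 < e -> exists n, rho (h n) < e) ->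
  (forall n, {ae P, forall w, f w <= g w + h n w}) ->
  {ae P, forall w, f w <= g w}.
Proof.
move=> mf mg mh hs H.
pose u w := Num.max 0 (f w - g w).
have mu : measurable_fun setT u.
  by apply: measurable_maxr => //; apply: measurable_funB.
suff /(rho_eq0 mu) : rho u <= 0.
  by apply: filterS => w; rewrite /u; case: (leP 0 (f w - g w)); lra.
apply/ler_addgt0Pl => e e0; rewrite addr0; have [n hn] := hs _ e0.
apply: le_trans (ltW hn); apply: rho_le => //.
apply: filterS (H n) => w Hw; rewrite /u.
have := ler_norm (h n w); have := normr_ge0 (h n w).
move=> h1 h2; case: (leP 0 (f w - g w)) => h0; last by rewrite normr0.
by rewrite ger0_norm //; lra.
Qed.

End Rho.

(** * Monotone limits and bounds in mean *)

Section Sup.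
Context {d : measure_display} {T : measurableType d} {R : realType}.
Variable P : probability T R.
Implicit Types f g h k : T -> R.
Local Notation rho := (rho P).

(** The absolute value allows inversion to be read as the real power [-1]. The inverse of [0] is
    [0], so quotients by a norm make sense everywhere. *)
Lemma measurable_invn f : measurable_fun setT f ->
  measurable_fun setT (fun w => `|f w|^-1).
Proof.
move=> mf; rewrite (_ : (fun _ => _) = (fun w => `|f w| `^ (-1))); last first.
  by apply/funext => w; rewrite powR_inv1.
apply: (measurableT_comp (measurable_powR (-1))); exact: measurable_abs.
Qed.

(** Boundedness in probability forbids the pointwise supremum to be infinite with positive
    probability; monotonicity turns bounds on each [f n] separately into a bound on the supremum and
    makes the convergence one in probability. *)
Lemma ae_increasing_sup (f : nat -> T -> R) :
  (forall n, measurable_fun setT (f n)) ->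
  (forall n, {ae P, forall w, 0 <= f n w}) ->
  (forall n, {ae P, forall w, f n w <= f n.+1 w}) ->
  (forall e, 0 < e -> exists2 c, 0 < c & forall n, rho (fun w => c * f n w) <= e) ->
  exists G : T -> R,
    [/\ measurable_fun setT G,
        forall n, {ae P, forall w, f n w <= G w},
        forall H, measurable_fun setT H -> (forall n, {ae P, forall w, f n w <= H w}) ->
          {ae P, forall w, G w <= H w} &
        forall e, 0 < e -> exists n, rho (fun w => G w - f n w) < e].
Proof.
move=> mf f0 fS fb.
pose GE w : \bar R := esups (fun n => (f n w)%:E) 0.
have mGE : measurable_fun setT GE.
  by apply: measurable_fun_esups => n; apply/measurable_EFinP.
pose G w := fine (GE w).
have mG : measurable_fun setT G.
  exact: (measurableT_comp (@fine_measurable R setT measurableT)).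
have geGE n w : ((f n w)%:E <= GE w)%E.
  by apply: ereal_sup_ubound; exists n.
have leGE w (x : \bar R) : (forall n, ((f n w)%:E <= x)%E) -> (GE w <= x)%E.
  by move=> H; apply: ge_ereal_sup => _ [n _ <-].
have mono : {ae P, forall w, forall m n, (m <= n)%N -> f m w <= f n w}.
  apply: filterS (ae_foralln fS) => w H m n; elim: n => [|n IH].
    by rewrite leqn0 => /eqP ->.
  by rewrite leq_eqVlt => /predU1P[->//|mn]; apply: le_trans (H n); apply: IH.
pose A := [set w | GE w = +oo%E].
have mA : measurable A.
  rewrite (_ : A = setT `&` GE @^-1` [set +oo%E]); last by rewrite setTI.
  exact: mGE.
have mi := @measurable_indic _ T R setT _ mA.
have hfin : {ae P, forall w, GE w \is a fin_num}.
  suff : rho \1_A <= 0.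
    move=> /(rho_eq0 mi); apply: filterS => w; rewrite indicE => hw.
    rewrite fin_numE -!ltNye; apply/andP; split.
      exact: lt_le_trans (ltNyr _) (geGE 0%N w).
    apply: contra_eqN hw => /eqP hw; rewrite (_ : w \in A); last exact: mem_set.
    by rewrite oner_eq0.
  apply/ler_addgt0Pl => e e0; rewrite addr0.
  have e20 : 0 < e / 2 by lra.
  have [c c0 Hc] := fb _ e20.
  (* On [A] the sequence [f n] is unbounded, so [h n] vanishes eventually, while the indicator of
     [A] is at most [c * f n + h n] in absolute values. Each term contributes [e / 2]. *)
  pose h n w : R := \1_A w * Num.max 0 (1 - c * f n w).
  have mcf n : measurable_fun setT (fun w => c * f n w) by exact: measurable_funM.
  have mh n : measurable_fun setT (h n).
    apply: measurable_funM => //; apply: measurable_maxr => //.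
    exact: measurable_funB.
  have /cvgrPdist_lt /(_ _ e20) [N _ HN] :
      rho (h n) @[n --> \oo] --> (0 : R).
    apply: rho_cvg0 => //; apply: filterS mono => w mw.
    case: (pselect (A w)) => Aw; last first.
      rewrite (_ : (fun n => h n w) = cst 0); first exact: cvg_cst.
      apply/funext => n; rewrite /h indicE (_ : (w \in A) = false) ?mul0r //.
      by apply/negP => /set_mem.
    have [N hN] : exists N, c^-1 <= f N w.
      apply: contrapT => /forallNP hN.
      have : (GE w <= (c^-1)%:E)%E.
        by apply: leGE => n; rewrite lee_fin; apply/ltW; rewrite ltNge; apply/negP.
      by rewrite Aw.
    apply: cvg_near_cst; exists N => // n /= Nn.
    rewrite /h max_l ?mulr0 // subr_le0.
    rewrite -ler_pdivrMl // mulr1; exact: le_trans hN (mw _ _ Nn).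
  have := HN N (leqnn N); rewrite sub0r normrN ger0_norm ?rho_ge0 // => hN.
  apply: (@le_trans _ _ (rho (fun w => c * f N w) + rho (h N))); last first.
    by have := Hc N; lra.
  apply: rho_add => //; apply: aeW => w; rewrite /h indicE.
  case: (w \in A) => /=; rewrite ?mul1r ?mul0r ?normr0 ?addr0 //.
  rewrite normr1; case: (leP 0 (1 - c * f N w)) => h0.
    rewrite (ger0_norm h0); have := ler_norm (c * f N w); lra.
  rewrite normr0; have := ler_norm (c * f N w); lra.
exists G; split => //.
- move=> n; apply: filterS hfin => w hw.
  by rewrite -lee_fin /G fineK.
- move=> H mH HH; apply: filterS2 hfin (ae_foralln HH) => w hw Hw.
  by rewrite -lee_fin /G fineK //; apply: leGE => n; rewrite lee_fin.
- move=> e e0.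
  have /cvgrPdist_lt /(_ _ e0) [N _ HN] :
      rho (fun w => G w - f n w) @[n --> \oo] --> (0 : R).
    apply: rho_cvg0; first by move=> n; apply: measurable_funB.
    apply: filterS2 hfin mono => w hw mw.
    apply/cvgrPdist_lt => r r0.
    have [N hN] : exists N, G w - r < f N w.
      apply: contrapT => /forallNP hN.
      have : (GE w <= (G w - r)%:E)%E.
        by apply: leGE => n; rewrite lee_fin leNgt; apply/negP.
      by rewrite -(fineK hw) lee_fin -/(G w); lra.
    exists N => // n /= Nn; have := mw _ _ Nn.
    have : f n w <= G w by rewrite -lee_fin /G fineK.
    by rewrite sub0r normrN => h1 h2; rewrite ger0_norm; lra.
  exists N; have := HN N (leqnn N).
  by rewrite sub0r normrN ger0_norm ?rho_ge0.
Qed.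

(* [C * rho (f / C)] is the expectation of [min C |f|]. *)
Definition L1le f (c : R) := forall C, 0 < C -> C * rho (fun w => C^-1 * f w) <= c.

Lemma L1le_rho f c : measurable_fun setT f -> L1le f c -> rho f <= c.
Proof.
move=> mf /(_ 1 ltr01); rewrite mul1r invr1; apply: le_trans.
apply: rho_le => //; first exact: measurable_funM.
by apply: aeW => w; rewrite mul1r.
Qed.

Lemma L1le_mono f a b : a <= b -> L1le f a -> L1le f b.
Proof. by move=> ab H C C0; apply: le_trans (H C C0) ab. Qed.

Lemma L1le_add f g h a b : measurable_fun setT f -> measurable_fun setT g ->
  measurable_fun setT h -> {ae P, forall w, `|f w| <= `|g w| + `|h w|} ->
  L1le g a -> L1le h b -> L1le f (a + b).
Proof.
move=> mf mg mh H La Lb C C0; apply: le_trans (lerD (La C C0) (Lb C C0)).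
rewrite -mulrDr ler_pM2l //; apply: rho_add; try exact: measurable_funM.
apply: filterS H => w H; rewrite !normrM -mulrDr ler_wpM2l //.
Qed.

Lemma L1le_ae f g c : measurable_fun setT f -> measurable_fun setT g ->
  {ae P, forall w, `|f w| <= `|g w|} -> L1le g c -> L1le f c.
Proof.
move=> mf mg H Lg C C0; apply: le_trans (Lg C C0).
rewrite ler_pM2l //; apply: rho_le; try exact: measurable_funM.
by apply: filterS H => w H; rewrite !normrM ler_wpM2l.
Qed.

Lemma L1le0 : L1le (fun _ => 0) 0.
Proof.
move=> C C0; rewrite mulr0 rho_cst ?mulr0 //.
by rewrite lexx ler01.
Qed.

Lemma L1le_scale r f c : measurable_fun setT f -> L1le f c ->
  L1le (fun w => r * f w) (`|r| * c).
Proof.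
move=> mf Lf; have [->|r0] := eqVneq r 0.
  rewrite normr0 mul0r; apply: L1le_ae L1le0 => //; first exact: measurable_funM.
  by apply: aeW => w; rewrite mul0r.
move=> C C0; have nr : 0 < `|r| by rewrite normr_gt0.
have := Lf (C / `|r|) (divr_gt0 C0 nr).
rewrite -(ler_pM2l nr); apply: le_trans.
rewrite mulrA (mulrC `|r|) divfK ?gt_eqF // ler_pM2l //.
apply: rho_le.
- by apply: measurable_funM => //; apply: measurable_funM.
- exact: measurable_funM.
apply: aeW => w; rewrite invf_div !normrM normrV ?unitfE ?gt_eqF //.
by rewrite normr_id; have -> (x y z : R) : x * (y * z) = y * x * z by rewrite mulrCA mulrA.
Qed.

(** Clipping loses at most a factor [B]: [|f| <= B * clip f]. This is the passage from smallness in
    probability to smallness in mean. *)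
Lemma L1le_bounded B f : 1 <= B -> measurable_fun setT f ->
  {ae P, forall w, `|f w| <= B} -> L1le f (B * rho f).
Proof.
move=> B1 mf H C C0; apply: rho_scaled => //; first exact: ltW.
- exact: le_trans B1.
- exact: measurable_funM.
apply: filterS H => w H; apply: (@le_trans _ _ `|f w|).
  apply: (@le_trans _ _ (C * `|C^-1 * f w|)).
    by rewrite ler_pM2l // clip_le.
  by rewrite normrM gtr0_norm ?invr_gt0 // mulrA mulfV ?mul1r ?gt_eqF.
rewrite /clip; have := normr_ge0 (f w).
by case: (leP 1 `|f w|) => h1 h2; nra.
Qed.

(** A form of Fatou's lemma for limits in probability: for each fixed [C], the truncated expectation
    [C * rho (f / C)] is continuous with respect to [rho]. *)
Lemma L1le_closed f c : measurable_fun setT f ->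
  (forall e, 0 < e -> exists g h, [/\ measurable_fun setT g, measurable_fun setT h,
     {ae P, forall w, `|f w| <= `|g w| + `|h w|}, L1le g (c + e) & rho h < e]) ->
  L1le f c.
Proof.
move=> mf H C C0; apply/ler_addgt0Pl => e e0.
(* [M] adds up the two errors: [e / M] from the bound on [g], and [C * max 1 |1 / C|] times [e / M]
   from [h]. *)
pose M := 1 + C * Num.max 1 `|C^-1|.
have M0 : 0 < M.
  by rewrite ltr_wpDr // mulr_ge0 ?(ltW C0) // le_max ler01.
have [g [h [mg mh fgh Lg rh]]] := H (e / M) (divr_gt0 e0 M0).
have h1 : C * rho (fun w => C^-1 * h w) <= C * (Num.max 1 `|C^-1| * (e / M)).
  rewrite ler_pM2l //; apply: le_trans (rho_mulr _ _ mh) _.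
  by rewrite ler_wpM2l ?le_max ?ler01 // ltW.
have h2 := Lg C C0.
have h3 : e / M + C * (Num.max 1 `|C^-1| * (e / M)) = e.
  by rewrite (mulrA C) -[X in X + _]mul1r -mulrDl mulrC divfK // gt_eqF.
apply: (@le_trans _ _ (C * (rho (fun w => C^-1 * g w) + rho (fun w => C^-1 * h w)))).
  rewrite ler_pM2l //; apply: rho_add; try exact: measurable_funM.
  by apply: filterS fgh => w fgh; rewrite !normrM -mulrDr ler_wpM2l.
by rewrite mulrDr; lra.
Qed.

End Sup.

(** * RN modules and their continuous seminorms *)

Ltac ae_with H := have := H; apply: filter_app.

Section Module.
Context {d : measure_display} {T : measurableType d} {R : realType}.
Variables (P : probability T R) (isC : bool) (S : zmodType).
Variable M : RNModule P isC S.
Implicit Types (x y z : S) (xi eta : T -> R).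
Local Notation nrm := (rn_norm M).
Local Notation rho := (rho P).

(** Truncation, normalisation and gluing only need real random scalars; with zero imaginary part
    they are admissible for both values of [isC]. *)
Definition rscale xi x : S := rn_scale M (fun w => Complex (xi w) 0) x.

Definition rn x : R := rho (nrm x).

Lemma L0K_real xi : measurable_fun setT xi ->
  @L0K d T R isC (fun w => Complex (xi w) 0).
Proof. by move=> mxi; split=> //; split => //; case: isC. Qed.

Lemma nrm_meas x : measurable_fun setT (nrm x).
Proof. by have [] := rn_norm_L0 M x. Qed.

Lemma nrm_ge0 x : {ae P, forall w, 0 <= nrm x w}.
Proof. by have [] := rn_norm_L0 M x. Qed.

#[local] Hint Resolve nrm_meas : core.

Lemma rscaleDr xi x y : measurable_fun setT xi ->
  rscale xi (x + y) = rscale xi x + rscale xi y.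
Proof. by move=> mxi; apply: rn_scaleDr; apply: L0K_real. Qed.

Lemma rscaleDl xi eta x : measurable_fun setT xi -> measurable_fun setT eta ->
  rscale (fun w => xi w + eta w) x = rscale xi x + rscale eta x.
Proof.
move=> mxi meta; rewrite /rscale -rn_scaleDl; try exact: L0K_real.
by congr rn_scale; apply/funext => w; rewrite /GRing.add /= addr0.
Qed.

Lemma rscaleA xi eta x : measurable_fun setT xi -> measurable_fun setT eta ->
  rscale (fun w => xi w * eta w) x = rscale xi (rscale eta x).
Proof.
move=> mxi meta; rewrite /rscale -rn_scaleA; try exact: L0K_real.
congr rn_scale; apply/funext => w.
by rewrite [RHS]/GRing.mul /= !mulr0 mul0r subr0 addr0.
Qed.

Lemma rscale1 x : rscale (fun _ => 1) x = x.
Proof. exact: rn_scale1. Qed.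

Lemma rscale0 x : rscale (fun _ => 0) x = 0.
Proof.
apply: (addIr (rscale (fun _ => 0) x)); rewrite add0r -rscaleDl //.
by congr rscale; apply/funext => w; rewrite addr0.
Qed.

Lemma rscaler0 xi : measurable_fun setT xi -> rscale xi 0 = 0.
Proof.
by move=> mxi; apply: (addIr (rscale xi 0)); rewrite add0r -rscaleDr // addr0.
Qed.

Lemma rscaleN1 x : rscale (fun _ => -1) x = - x.
Proof.
apply/eqP; rewrite -addr_eq0 -{2}(rscale1 x) -rscaleDl //; apply/eqP.
by rewrite -[RHS](rscale0 x); congr rscale; apply/funext => w; rewrite addNr.
Qed.

Lemma rscaleN xi x : measurable_fun setT xi -> rscale xi (- x) = - rscale xi x.
Proof.
by move=> mxi; apply/eqP; rewrite -addr_eq0 -rscaleDr // addNr rscaler0.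
Qed.

Lemma rscaleB xi x y : measurable_fun setT xi ->
  rscale xi (x - y) = rscale xi x - rscale xi y.
Proof. by move=> mxi; rewrite rscaleDr // rscaleN. Qed.

Lemma nrmZ xi x : measurable_fun setT xi ->
  {ae P, forall w, nrm (rscale xi x) w = `|xi w| * nrm x w}.
Proof.
move=> mxi; apply: filterS (rn_normZ M x (L0K_real mxi)) => w ->.
by rewrite /Normc.normc /= expr0n /= addr0 sqrtr_sqr.
Qed.

Lemma nrmD x y : {ae P, forall w, nrm (x + y) w <= nrm x w + nrm y w}.
Proof. exact: rn_normD. Qed.

Lemma nrm0 : {ae P, forall w, nrm 0 w = 0}.
Proof.
rewrite -(rscale0 0); apply: filterS (nrmZ 0 (@measurable_cst _ _ T R setT 0)) => w ->.
by rewrite normr0 mul0r.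
Qed.

Lemma nrmN x : {ae P, forall w, nrm (- x) w = nrm x w}.
Proof.
rewrite -rscaleN1; apply: filterS (nrmZ x (@measurable_cst _ _ T R setT (-1))) => w ->.
by rewrite normrN1 mul1r.
Qed.

Lemma nrmB x y : {ae P, forall w, nrm (x - y) w <= nrm x w + nrm y w}.
Proof. by apply: filterS2 (nrmD x (- y)) (nrmN y) => w h <-. Qed.

Lemma rn_ge0 x : 0 <= rn x. Proof. exact: rho_ge0. Qed.

Lemma rnN x : rn (- x) = rn x.
Proof.
by apply/le_anti/andP; split; apply: rho_le => //; apply: filterS (nrmN x) => w ->.
Qed.

Lemma nrm_sub x y : {ae P, forall w, nrm x w - nrm y w <= nrm (x - y) w}.
Proof. by have := nrmD (x - y) y; rewrite subrK; apply: filterS => w; lra. Qed.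

Lemma rnD x y : rn (x + y) <= rn x + rn y.
Proof.
apply: rho_add => //.
ae_with (nrmD x y); ae_with (nrm_ge0 x); ae_with (nrm_ge0 y).
ae_with (nrm_ge0 (x + y)); apply: aeW => w h1 h2 h3 h4.
by rewrite !ger0_norm.
Qed.

Lemma rn0 : rn 0 = 0.
Proof.
apply/le_anti; rewrite rn_ge0 andbT; apply: rho_bound => //.
by apply: filterS nrm0 => w ->; rewrite normr0.
Qed.

Lemma rnB x y : rn (x - y) <= rn x + rn y.
Proof. by rewrite -(rnN y); apply: rnD. Qed.

Lemma rn_distC x y : rn (x - y) = rn (y - x).
Proof. by rewrite -rnN opprB. Qed.

Lemma rn_tri x y z : rn (x - z) <= rn (x - y) + rn (y - z).
Proof. by apply: le_trans (rnD _ _); rewrite addrA subrK. Qed.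

Lemma rn_cscale (c : R) x : rn (rscale (fun _ => c) x) <= Num.max 1 `|c| * rn x.
Proof.
apply: le_trans (rho_mulr P c (nrm_meas x)); apply: rho_le => //.
  exact: measurable_funM.
ae_with (nrmZ x (@measurable_cst _ _ T R setT c)); ae_with (nrm_ge0 x).
by apply: aeW => w h ->; rewrite !normrM normr_id.
Qed.

Lemma tail_lt x (e lam : R) : 0 < e -> rn x < lam / Num.max 1 e^-1 ->
  (tailP M x e < lam%:E)%E.
Proof.
move=> e0; rewrite ltr_pdivlMr; last by rewrite lt_max ltr01.
move=> h; apply: le_lt_trans (markov_rho P e0 (nrm_meas x)) _.
by rewrite lte_fin mulrC.
Qed.

Lemma rn_lt_tail x (e lam : R) : 0 < e -> (tailP M x e < lam%:E)%E -> rn x < e + lam.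
Proof.
move=> e0 h; rewrite -lte_fin.
apply: le_lt_trans (rho_le_tail e0 (nrm_meas x) (nrm_ge0 x)) _.
by rewrite EFinD lteD2lE.
Qed.

Lemma rn_cvgP {I : Type} (F : set_system I) (FF : Filter F) (g : I -> S) x :
  rn_cvg M F g x <-> (forall e, 0 < e -> \forall i \near F, rn (g i - x) < e).
Proof.
split=> H.
  move=> e e0; have e20 : 0 < e / 2 by lra.
  apply: filterS (H _ _ e20 e20) => i /(rn_lt_tail e20).
  by rewrite -splitr.
move=> e lam e0 l0; apply: filterS (H (lam / Num.max 1 e^-1) _) => [i|].
  exact: tail_lt.
by rewrite divr_gt0 // lt_max ltr01.
Qed.

Lemma rn_complete_seq (u : nat -> S) : rn_complete M ->
  (forall e, 0 < e -> exists N, forall m n, (N <= m)%N -> (N <= n)%N ->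
     rn (u m - u n) < e) ->
  exists x, forall e, 0 < e -> exists N, forall n, (N <= n)%N -> rn (u n - x) < e.
Proof.
move=> cM H; have [|x /rn_cvgP Hx] := cM u.
  move=> e lam e0 l0; have [|N HN] := H (lam / Num.max 1 e^-1).
    by rewrite divr_gt0 // lt_max ltr01.
  by exists N => m n Nm Nn; apply: tail_lt => //; apply: HN.
by exists x => e e0; have [N _ HN] := Hx _ e0; exists N => n; apply: HN.
Qed.

(* The seminorms [x |-> ||A x||] of [A \in B(S)] and their finite maxima. *)
Record modsn (p : S -> T -> R) : Prop := ModSN {
  ms_meas : forall x, measurable_fun setT (p x) ;
  ms_ge0 : forall x, {ae P, forall w, 0 <= p x w} ;
  msD : forall x y, {ae P, forall w, p (x + y) w <= p x w + p y w} ;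
  msZ : forall xi x, measurable_fun setT xi ->
    {ae P, forall w, p (rscale xi x) w = `|xi w| * p x w} ;
  ms_cont : forall e, 0 < e ->
    exists2 c, 0 < c & forall x, rn x < c -> rho (p x) < e }.

Section Op.
Variable A : S -> S.
Hypothesis bA : rn_bounded_op M A.

Lemma opD x y : A (x + y) = A x + A y. Proof. by case: bA. Qed.

Lemma op0 : A 0 = 0.
Proof. by apply: (addIr (A 0)); rewrite -opD addr0 add0r. Qed.

Lemma opN x : A (- x) = - A x.
Proof. by apply/eqP; rewrite -addr_eq0 -opD addNr op0. Qed.

Lemma opB x y : A (x - y) = A x - A y. Proof. by rewrite opD opN. Qed.

Lemma opZ xi x : measurable_fun setT xi -> A (rscale xi x) = rscale xi (A x).
Proof. by move=> mxi; case: bA => _ [h _]; apply: h; apply: L0K_real. Qed.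

Lemma op_cont e : 0 < e -> exists2 c, 0 < c & forall x, rn x < c -> rn (A x) < e.
Proof.
move=> e0; have e20 : 0 < e / 2 by lra.
have [_ [_ /(_ 0 _ _ e20 e20)[del [mu [d0 [m0 H]]]]]] := bA.
exists (mu / Num.max 1 del^-1); first by rewrite divr_gt0 // lt_max ltr01.
move=> x hx; have := H x; rewrite op0 !subr0 => /(_ (tail_lt d0 hx)).
by move/(rn_lt_tail e20); rewrite -splitr.
Qed.

Lemma op_modsn : modsn (fun x => nrm (A x)).
Proof.
split.
- by move=> x; apply: nrm_meas.
- by move=> x; apply: nrm_ge0.
- by move=> x y; rewrite opD; apply: nrmD.
- by move=> xi x mxi; rewrite opZ //; apply: nrmZ.
- exact: op_cont.
Qed.

End Op.

(** Starting from [p 0] rather than from [0] does not change the maximum for [n > 0] and keeps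
    [maxsn_le] valid at every point, although the seminorms are nonnegative only a.s. *)
Fixpoint maxsn (p : nat -> S -> T -> R) (n : nat) (x : S) (w : T) : R :=
  if n is m.+1 then Num.max (maxsn p m x w) (p m x w) else p 0 x w.

Lemma maxsn_ge p n i x w : (i < n)%N -> p i x w <= maxsn p n x w.
Proof.
elim: n => //= n IH; rewrite ltnS leq_eqVlt => /predU1P[->|/IH h].
  by rewrite le_max lexx orbT.
by rewrite le_max h.
Qed.

Lemma maxsn_le p n x w (a : R) : (0 < n)%N ->
  (forall i, (i < n)%N -> p i x w <= a) -> maxsn p n x w <= a.
Proof.
case: n => // n _ H; have H0 : p 0%N x w <= a by exact: H.
elim: n.+1 H => //= m IH H; rewrite ge_max H // andbT.
by apply: IH => i im; apply: H; rewrite ltnS ltnW.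
Qed.

Lemma maxsn_modsn p n : (forall i, (i < n.+1)%N -> modsn (p i)) ->
  modsn (maxsn p n.+1).
Proof.
elim: n => [|n IH] Hp.
  rewrite (_ : maxsn p 1 = p 0%N); first exact: Hp.
  by apply/funext => x; apply/funext => w /=; rewrite maxxx.
have h1 : modsn (p n.+1) by exact: Hp.
have {IH}h2 : modsn (maxsn p n.+1).
  by apply: IH => i h; apply: Hp; rewrite ltnS ltnW.
split.
- by move=> x; apply: measurable_maxr; [apply: (ms_meas h2)|apply: (ms_meas h1)].
- by move=> x; apply: filterS (ms_ge0 h1 x) => w h; rewrite le_max [X in _ || X]h orbT.
- move=> x y; ae_with (msD h1 x y); ae_with (msD h2 x y); apply: aeW => w.
  rewrite /= -/(maxsn p n.+1 _ _) => a b; rewrite ge_max; apply/andP; split.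
    by apply: le_trans a _; apply: lerD; rewrite le_max lexx.
  by apply: le_trans b _; apply: lerD; rewrite le_max lexx orbT.
- move=> xi x mxi; ae_with (msZ h1 x mxi); ae_with (msZ h2 x mxi).
  apply: aeW => w a b.
  change (Num.max (maxsn p n.+1 (rscale xi x) w) (p n.+1 (rscale xi x) w) =
    `|xi w| * Num.max (maxsn p n.+1 x w) (p n.+1 x w)).
  rewrite a b; symmetry; apply: maxr_pMr; exact: normr_ge0.
- move=> e e0; have e20 : 0 < e / 2 by lra.
  have [c c0 hc] := ms_cont h1 e20; have [c' c'0 hc'] := ms_cont h2 e20.
  exists (Num.min c c'); first by rewrite lt_min c0.
  move=> x; rewrite lt_min => /andP[/hc a /hc' b].
  apply: (@le_lt_trans _ _ (rho (maxsn p n.+1 x) + rho (p n.+1 x))); last by lra.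
  apply: rho_add; [|exact: (ms_meas h2)|exact: (ms_meas h1)|].
    by apply: measurable_maxr; [apply: (ms_meas h2)|apply: (ms_meas h1)].
  apply: aeW => w.
  change (`|Num.max (maxsn p n.+1 x w) (p n.+1 x w)| <=
     `|maxsn p n.+1 x w| + `|p n.+1 x w|).
  by have [_|_] := leP (maxsn p n.+1 x w) (p n.+1 x w); rewrite ?lerDl ?lerDr normr_ge0.
Qed.

Section ModSN.
Variables (p : S -> T -> R) (hp : modsn p).

Lemma ms0 : {ae P, forall w, p 0 w = 0}.
Proof.
have := msZ hp 0 (@measurable_cst _ _ T R setT 0); rewrite rscale0.
by apply: filterS => w ->; rewrite normr0 mul0r.
Qed.

Lemma msN x : {ae P, forall w, p (- x) w = p x w}.
Proof.
have := msZ hp x (@measurable_cst _ _ T R setT (-1)); rewrite rscaleN1.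
by apply: filterS => w ->; rewrite normrN1 mul1r.
Qed.

Lemma rho_msD (c : R) x y : rho (fun w => c * p (x + y) w) <=
  rho (fun w => c * p x w) + rho (fun w => c * p y w).
Proof.
have m z : measurable_fun setT (fun w => c * p z w).
  by apply: measurable_funM => //; apply: (ms_meas hp).
apply: rho_add => //.
ae_with (msD hp x y); ae_with (ms_ge0 hp x); ae_with (ms_ge0 hp y).
ae_with (ms_ge0 hp (x + y)); apply: aeW => w h1 h2 h3 h4.
rewrite !normrM -mulrDr ler_wpM2l //.
by rewrite !ger0_norm.
Qed.

Lemma rho_msN (c : R) x : rho (fun w => c * p (- x) w) = rho (fun w => c * p x w).
Proof.
have m z : measurable_fun setT (fun w => c * p z w).
  by apply: measurable_funM => //; apply: (ms_meas hp).
by apply/le_anti/andP; split; apply: rho_le => //; apply: filterS (msN x) => w ->.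
Qed.

Lemma rho_ms_le (c : R) x : 0 <= c <= 1 -> rho (fun w => c * p x w) <= rho (p x).
Proof.
move=> /andP[c0 c1]; apply: rho_le.
- by apply: measurable_funM => //; apply: (ms_meas hp).
- exact: (ms_meas hp).
by apply: aeW => w; rewrite normrM (ger0_norm c0) ler_piMl.
Qed.

End ModSN.

End Module.

(** * Gluing of vectors and the random norm of a seminorm *)

Section OpNorm.
Context {d : measure_display} {T : measurableType d} {R : realType}.
Variables (P : probability T R) (isC : bool) (S : zmodType).
Variable M : RNModule P isC S.
Implicit Types (x y z : S) (xi eta : T -> R).
Local Notation nrm := (rn_norm M).
Local Notation rho := (rho P).
Local Notation rn := (rn M).
Local Notation rscale := (rscale M).
Local Notation modsn := (modsn M).
#[local] Hint Resolve nrm_meas : core.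

Definition in_ball x := {ae P, forall w, nrm x w <= 1}.

Lemma measurable_bool_real (b : T -> bool) : measurable_fun setT b ->
  measurable_fun setT (fun w => (b w)%:R : R).
Proof.
move=> mb; rewrite (_ : (fun _ => _) = (fun w => if b w then 1 else 0)).
  exact: measurable_fun_ifT.
by apply/funext => w; case: (b w).
Qed.

Lemma nrm_modsn : modsn nrm.
Proof.
split=> //.
- exact: nrm_ge0.
- exact: nrmD.
- exact: nrmZ.
- by move=> e e0; exists e.
Qed.

(** Concatenation of two vectors along an event. The unit ball is stable under it, so the functions
    [p x], for [x] in the ball, form an upward directed family. *)
Definition glue (b : T -> bool) x y :=
  rscale (fun w => (b w)%:R) x + rscale (fun w => (~~ b w)%:R) y.

Lemma ms_glue p b x y : modsn p -> measurable_fun setT b ->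
  {ae P, forall w, p (glue b x y) w = if b w then p x w else p y w}.
Proof.
move=> hp mb.
have mb' : measurable_fun setT (fun w => ~~ b w).
  exact: measurable_neg.
have mi := measurable_bool_real mb; have mj := measurable_bool_real mb'.
(* Multiplying by an indicator removes one of the two pieces; homogeneity of [p] then reads off its
   value on that event. *)
have E1 : rscale (fun w => (b w)%:R) (glue b x y) = rscale (fun w => (b w)%:R) x.
  rewrite /glue rscaleDr // -!rscaleA // -[RHS]addr0 -(rscale0 M y).
  by congr (_ + _); congr rscale; apply/funext => w; case: (b w);
     rewrite /= ?mulr1 ?mulr0 ?mul0r.
have E2 : rscale (fun w => (~~ b w)%:R) (glue b x y) = rscale (fun w => (~~ b w)%:R) y.
  rewrite /glue rscaleDr // -!rscaleA // -[RHS]add0r -(rscale0 M x).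
  by congr (_ + _); congr rscale; apply/funext => w; case: (b w);
     rewrite /= ?mulr1 ?mulr0 ?mul0r.
ae_with (msZ hp (glue b x y) mi); ae_with (msZ hp (glue b x y) mj).
ae_with (msZ hp x mi); ae_with (msZ hp y mj); apply: aeW => w.
rewrite E1 E2 => -> ->.
by case: (b w); rewrite /= normr1 normr0 !mul0r !mul1r.
Qed.

Lemma in_ball_glue b x y : measurable_fun setT b -> in_ball x -> in_ball y ->
  in_ball (glue b x y).
Proof.
move=> mb hx hy; rewrite /in_ball; ae_with (ms_glue x y nrm_modsn mb).
by ae_with hx; ae_with hy; apply: aeW => w h1 h2 ->; case: (b w).
Qed.

Lemma ms_bdd p : modsn p -> forall e, 0 < e ->
  exists2 c, 0 < c & forall x, in_ball x -> rho (fun w => c * p x w) <= e.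
Proof.
move=> hp e e0; have [c c0 Hc] := ms_cont hp e0.
have c20 : 0 < c / 2 by lra.
have mc : measurable_fun setT (fun _ : T => c / 2) by exact: measurable_cst.
exists (c / 2) => // x hx; apply/ltW.
apply: le_lt_trans (Hc (rscale (fun _ => c / 2) x) _).
  apply: rho_le; last by apply: filterS (msZ hp x mc) => w ->; rewrite normrM [leRHS]normrM normr_id.
    by apply: measurable_funM => //; apply: (ms_meas hp).
  exact: (ms_meas hp).
apply: (@le_lt_trans _ _ (c / 2)); last by lra.
apply: rho_bound => //; first exact: ltW.
ae_with hx; ae_with (nrmZ M x mc); ae_with (nrm_ge0 M x); apply: aeW => w h0 -> h.
by rewrite normrM normr_id (gtr0_norm c20) (ger0_norm h0) ler_piMr // ltW.
Qed.

(** This is [r / (1 + r)] for [r >= 0]. Unlike clipping, which is constant beyond [1], it is bounded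
    and strictly increasing, so a maximal expectation forces maximal values. *)
Let psi (r : R) := r * `|1 + `|r| |^-1.

Let psi_ge0 r : 0 <= r -> 0 <= psi r.
Proof. by move=> r0; rewrite /psi mulr_ge0. Qed.

Let psiE r : 0 <= r -> psi r * (1 + r) = r.
Proof.
move=> r0; rewrite /psi (ger0_norm r0) ger0_norm ?addr_ge0 //.
by rewrite divfK // gt_eqF // ltr_pwDl.
Qed.

Let psi_le1 r : 0 <= r -> psi r <= 1.
Proof. by move=> r0; have := psiE r0; have := psi_ge0 r0; nra. Qed.

Let psi_leP r s : 0 <= r -> 0 <= s -> (psi r <= psi s) = (r <= s).
Proof.
move=> r0 s0; have := psiE r0; have := psiE s0.
have := psi_ge0 r0; have := psi_ge0 s0.
move: (psi r) (psi s) => a b b0 a0 ea eb.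
have a1 : 0 < 1 - a by nra.
have b1 : 0 < 1 - b by nra.
have era : r * (1 - a) = a by lra.
have esb : s * (1 - b) = b by lra.
apply/idP/idP => h.
  have : r * (1 - a) <= s * (1 - a) by rewrite era; nra.
  by rewrite ler_pM2r.
rewrite leNgt; apply/negP => ba.
have : s * (1 - b) < r * (1 - b) by rewrite esb; nra.
by rewrite ltr_pM2r // ltNge h.
Qed.

Let psi_meas (f : T -> R) : measurable_fun setT f -> measurable_fun setT (fun w => psi (f w)).
Proof.
move=> mf; apply: measurable_funM => //; apply: measurable_invn.
by apply: measurable_funD => //; apply: measurable_abs.
Qed.

(** Exhaustion: unit vectors whose [Phi] approaches the supremum [s] are glued successively, so that
    [p (x1 n)] increases, and [N] is the limit. Minimality of [N] and the passage of bounds uniform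
    over the ball to [N] both come from this approximation. *)
Lemma ms_opnorm p : modsn p -> exists N : T -> R,
  [/\ measurable_fun setT N,
      forall x, {ae P, forall w, p x w <= N w * nrm x w},
      forall H, measurable_fun setT H ->
        (forall x, in_ball x -> {ae P, forall w, p x w <= H w}) ->
        {ae P, forall w, N w <= H w},
      forall c e, (forall x, in_ball x -> rho (fun w => c * p x w) <= e) ->
        rho (fun w => c * N w) <= e &
      {ae P, forall w, 0 <= N w}].
Proof.
move=> hp; have mp := ms_meas hp; have p0 := ms_ge0 hp.
pose Phi x := rho (fun w => psi (p x w)).
have ball0 : in_ball 0.
  by rewrite /in_ball; ae_with (nrm0 M); apply: aeW => w ->.
have hs : has_sup [set Phi x | x in in_ball].
  split; first by exists (Phi 0), 0.
  by exists 1 => _ [x _ <-]; apply: rho_le1; apply: psi_meas.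
pose s := sup [set Phi x | x in in_ball].
have Phi_le x : in_ball x -> Phi x <= s.
  by move=> hx; apply: ub_le_sup; [case: hs|exists x].
have /choice [x0 Hx0] : forall n : nat, exists x, in_ball x /\ s - n.+1%:R^-1 < Phi x.
  move=> n; have n0 : (0 : R) < n.+1%:R^-1 by rewrite invr_gt0.
  by have [_ [x hx <-] h] := sup_adherent n0 hs; exists x.
pose cmp x y w := p y w <= p x w.
have mcmp x y : measurable_fun setT (cmp x y) by exact: measurable_fun_ler.
pose gl x y := glue (cmp x y) x y.
have glE x y : {ae P, forall w, p (gl x y) w = Num.max (p x w) (p y w)}.
  by apply: filterS (ms_glue x y hp (mcmp x y)) => w ->; rewrite /cmp; case: leP.
have gl_ball x y : in_ball x -> in_ball y -> in_ball (gl x y).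
  exact: in_ball_glue.
pose x1 := fix x1 n := if n is m.+1 then gl (x1 m) (x0 m.+1) else x0 0%N.
have x1b n : in_ball (x1 n).
  by elim: n => [|n IH] /=; [case: (Hx0 0%N)|apply: gl_ball => //; case: (Hx0 n.+1)].
have x1P n : s - n.+1%:R^-1 < Phi (x1 n).
  case: (Hx0 n) => _ h; apply: lt_le_trans h _; case: n => [|n] //=.
  apply: rho_le; try exact: psi_meas.
  ae_with (glE (x1 n) (x0 n.+1)); ae_with (p0 (x1 n)); ae_with (p0 (x0 n.+1)).
  apply: aeW => w h1 h2 ->; rewrite !ger0_norm ?psi_ge0 ?le_max ?h1 ?orbT //.
  by rewrite psi_leP ?le_max ?h1 ?lexx ?orbT.
have [|||e e0|G [mG leG minG apG]] := @ae_increasing_sup _ _ _ P (fun n => p (x1 n)).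
- by [].
- by [].
- move=> n /=; ae_with (glE (x1 n) (x0 n.+1)); apply: aeW => w ->.
  by rewrite le_max lexx.
- by have [c c0 Hc] := ms_bdd hp e0; exists c => // n; apply: Hc.
have G0 : {ae P, forall w, 0 <= G w}.
  by ae_with (leG 0%N); ae_with (p0 (x1 0%N)); apply: aeW => w; apply: le_trans.
have pG x : in_ball x -> {ae P, forall w, p x w <= G w}.
  (* [D] is the excess of [x] over [G]. Gluing [x] to [x1 n] raises [Phi (x1 n)], already within
     [1 / (n + 1)] of the supremum, by at least [rho D]; hence [rho D = 0]. *)
  move=> hx; pose D w := Num.max 0 (psi (p x w) - psi (G w)).
  have mD : measurable_fun setT D.
    by apply: measurable_maxr => //; apply: measurable_funB; apply: psi_meas.
  suff /(rho_eq0 mD) : rho D <= 0.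
    apply: filter_app; ae_with G0; ae_with (p0 x); apply: aeW => w h1 h2 h3.
    rewrite -psi_leP // -subr_le0 -h3 /D le_max lexx orbT //.
  apply/ler_addgt0Pl => e e0; rewrite addr0.
  have [n hn] : exists n : nat, n.+1%:R^-1 < e.
    by have [n _ /(_ n (leqnn n)) h] := near_infty_natSinv_lt (PosNum e0); exists n.
  have h1 := x1P n; have h2 := Phi_le _ (gl_ball _ _ (x1b n) hx).
  suff : Phi (x1 n) + rho D <= Phi (gl (x1 n) x).
    move=> h3; rewrite -(lerD2l (Phi (x1 n))); apply: (le_trans h3).
    apply: (le_trans h2); rewrite -lerBlDr; apply: le_trans (ltW h1).
    by rewrite lerD2l lerN2 ltW.
  have mq y : measurable_fun setT (fun w => psi (p y w)) by exact: psi_meas.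
  have := @rho_lin _ _ _ P 1 1 1 0 _ _ _ _ ler01 ler01 ler01 (lexx 0)
    (mq (x1 n)) mD (mq (gl (x1 n) x)) mD.
  rewrite !mul1r mul0r addr0; apply.
  ae_with (glE (x1 n) x); ae_with (leG n); ae_with (p0 x); ae_with (p0 (x1 n)).
  ae_with G0; apply: aeW => w g0 pn0 px0 png E0.
  rewrite !mul1r mul0r addr0 /clip /D E0.
  set a := p (x1 n) w in pn0 png *; set b := p x w in px0 *; set g := G w in g0 png *.
  have m0 : 0 <= Num.max a b by rewrite le_max pn0.
  have -> : Num.min 1 `|Num.max 0 (psi b - psi g)| = Num.max 0 (psi b - psi g).
    have := psi_le1 px0; have := psi_ge0 g0; case: (leP 0 (psi b - psi g)) => h A B.
      by rewrite ger0_norm // min_r //; lra.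
    by rewrite normr0 min_r.
  have cl r : 0 <= r -> Num.min 1 `|psi r| = psi r.
    by move=> r0; rewrite ger0_norm ?psi_ge0 // min_r // psi_le1.
  rewrite !cl //.
  have E : psi a <= psi g by rewrite psi_leP.
  have [ab|/ltW ba] := leP a b.
    have E2 : psi a <= psi b by rewrite psi_leP.
    by case: (leP 0 (psi b - psi g)); lra.
  have E2 : psi b <= psi a by rewrite psi_leP.
  by case: (leP 0 (psi b - psi g)); lra.
exists G; split => //.
(* Dividing [x] by its norm gives a vector of the unit ball. Where the norm vanishes this says
   nothing about [p x]; but there [z = 1], and [rscale z x = 0] forces [p x] to vanish. *)
- move=> x; have mi := measurable_invn (nrm_meas M x).
  pose z w : R := (nrm x w <= 0)%R%:R.
  have mz : measurable_fun setT z.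
    by apply: measurable_bool_real; apply: measurable_fun_ler.
  have hb : in_ball (rscale (fun w => `|nrm x w|^-1) x).
    rewrite /in_ball; ae_with (nrmZ M x mi); ae_with (nrm_ge0 M x).
    apply: aeW => w h ->; rewrite (ger0_norm h) normfV (ger0_norm h).
    have [->|h0] := eqVneq (nrm x w) 0; first by rewrite mulr0.
    by rewrite mulVf.
  have z0 : rscale z x = 0.
    apply: (rn_norm_eq0 (r := M)); ae_with (nrmZ M x mz); ae_with (nrm_ge0 M x).
    apply: aeW => w h ->; rewrite /z; case: (leP (nrm x w) 0) => h'.
      by rewrite (_ : nrm x w = 0) ?mulr0 //; apply/le_anti; rewrite h h'.
    by rewrite normr0 mul0r.
  have := msZ hp x mz; rewrite z0; apply: filter_app; ae_with (ms0 hp).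
  ae_with (pG _ hb); ae_with (msZ hp x mi); ae_with (nrm_ge0 M x).
  apply: aeW => w h0 -> hG ->; rewrite /z normfV normr_id (ger0_norm h0) in hG *.
  have [h1|h1] := leP (nrm x w) 0.
    rewrite normr1 mul1r => <-.
    by rewrite (_ : nrm x w = 0) ?mulr0 //; apply/le_anti; rewrite h0 h1.
  by move=> _; rewrite -ler_pdivrMr // mulrC.
- move=> H mH HH; apply: minG => // n; exact: HH.
- move=> c e He; apply/ler_addgt0Pl => r r0.
  have M0 : 0 < Num.max 1 `|c| by rewrite lt_max ltr01.
  have [n hn] := apG _ (divr_gt0 r0 M0).
  have mcp : measurable_fun setT (fun w => c * p (x1 n) w) by exact: measurable_funM.
  have mGp : measurable_fun setT (fun w => G w - p (x1 n) w) by exact: measurable_funB.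
  have mcG : measurable_fun setT (fun w => c * (G w - p (x1 n) w)).
    exact: measurable_funM.
  have : rho (fun w => c * G w) <=
      rho (fun w => c * (G w - p (x1 n) w)) + rho (fun w => c * p (x1 n) w).
    apply: rho_add => //; first exact: measurable_funM.
    by apply: aeW => w; rewrite -[X in `|X|](subrK (c * p (x1 n) w)) -mulrBr ler_normD.
  move/le_trans; apply; apply: lerD; last exact: He.
  apply: le_trans (rho_mulr _ _ mGp) _.
  by rewrite mulrC -ler_pdivlMr // ltW.
Qed.

End OpNorm.

(** * Gliding hump *)

Section GlidingHump.
Context {d : measure_display} {T : measurableType d} {R : realType}.
Variables (P : probability T R) (isC : bool) (S : zmodType).
Variable M : RNModule P isC S.
Implicit Types (x y z : S) (xi eta : T -> R).
Local Notation nrm := (rn_norm M).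
Local Notation rho := (rho P).
Local Notation rn := (rn M).
Local Notation rscale := (rscale M).
Local Notation modsn := (modsn M).
Local Notation half n := ((2^-1 : R) ^+ n).

Lemma pow2V_gt0 n : 0 < half n. Proof. by rewrite exprn_gt0. Qed.

Lemma pow2V_le1 n : half n <= 1.
Proof. by apply: exprn_ile1; rewrite ?invr_ge0 // invf_le1 ?ler1n. Qed.

Lemma pow2VS n : half n.+1 = half n / 2. Proof. by rewrite exprSr. Qed.

Lemma pow2V_anti m n : (m <= n)%N -> half n <= half m.
Proof. by move=> mn; apply: ler_wiXn2l => //; rewrite ?invr_ge0 // invf_le1 ?ler1n. Qed.

Lemma pow2V_small (e : R) : 0 < e -> exists N, forall m, (N <= m)%N -> half m < e.
Proof.
move=> e0; have : half n @[n --> \oo] --> (0 : R).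
  by apply: cvg_expr; rewrite ger0_norm ?invr_ge0 // invf_lt1 ?ltr1n.
move=> /cvgrPdist_lt /(_ _ e0) [N _ HN]; exists N => m /HN /=.
by rewrite sub0r normrN ger0_norm // ltW // pow2V_gt0.
Qed.

Lemma rho_ms_tri p c x y : modsn p ->
  rho (fun w => c * p x w) <= rho (fun w => c * p y w) + rho (fun w => c * p (x - y) w).
Proof. by move=> hp; have := rho_msD hp c y (x - y); rewrite addrC subrK. Qed.

Lemma rho_ms_double p c x : modsn p ->
  rho (fun w => c * p x w) <= rho (fun w => c * p (x + x) w).
Proof.
move=> hp; have m2 : measurable_fun setT (fun _ : T => 1 + 1 : R) by [].
have -> : x + x = rscale (fun _ => 1 + 1) x by rewrite rscaleDl // rscale1.
have m z : measurable_fun setT (fun w => c * p z w).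
  by apply: measurable_funM => //; apply: (ms_meas hp).
apply: rho_le => //; ae_with (msZ hp x m2); apply: aeW => w ->.
rewrite !normrM ler_wpM2l // normr_id ler_peMl //.
by rewrite ger0_norm ?addr_ge0 //; lra.
Qed.

(* The sign of each new term is chosen so that the hump survives, as in
   Sokal's proof of the uniform boundedness principle. *)
Lemma gliding_hump (p : nat -> S -> T -> R) (u : nat -> S) (q : R) :
  rn_complete M -> (forall n, modsn (p n)) -> (forall n, rn (u n) <= half n) ->
  0 < q -> (forall n, q <= rho (fun w => half n * p n (u n) w)) ->
  exists (s : nat -> S) (n_ : nat -> nat) (y : S),
  [/\ s 0%N = 0,
      forall k, s k.+1 = s k + u (n_ k) \/ s k.+1 = s k - u (n_ k),
      forall k, (k <= n_ k)%N,
      forall e, 0 < e -> exists N, forall m, (N <= m)%N -> rn (s m - y) < e &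
      forall k, q / 4 <= rho (fun w => half (n_ k) * p (n_ k) y w)].
Proof.
move=> cM hp hu q0 hq.
have /choice [f Hf] : forall kj : nat * nat, exists N, forall m, (N <= m)%N ->
    rho (p kj.2 (u m)) < half kj.1 * (q / 8).
  move=> [k j] /=; have e0 : 0 < half k * (q / 8).
    by rewrite mulr_gt0 ?pow2V_gt0 //; lra.
  have [c c0 Hc] := ms_cont (hp j) e0; have [N HN] := pow2V_small c0.
  by exists N => m /HN h; apply: Hc; apply: le_lt_trans (hu m) h.
(* From the index [g k] on, the vectors [u m] are negligible for all seminorms of index at most
   [k]. *)
pose g k := (\max_(j < k.+1) f (k, nat_of_ord j))%N.
have Hg k m j : (g k <= m)%N -> (j <= k)%N -> rho (p j (u m)) < half k * (q / 8).
  move=> gm jk; apply: (Hf (k, j)); apply: leq_trans gm.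
  have jk' : (j < k.+1)%N by [].
  exact: (@leq_bigmax _ (fun j : 'I_k.+1 => f (k, nat_of_ord j)) (Ordinal jk')).
pose n_ := fix n_ k := if k is l.+1 then maxn (g (n_ l)) (n_ l).+1 else 0%N.
have nS k : (n_ k < n_ k.+1)%N by rewrite /= leq_maxr.
have ngS k : (g (n_ k) <= n_ k.+1)%N by rewrite /= leq_maxl.
have nk k : (k <= n_ k)%N by elim: k => // k IH; apply: leq_ltn_trans (nS k).
have nmono i j : (i <= j)%N -> (n_ i <= n_ j)%N.
  elim: j => [|j IH]; first by rewrite leqn0 => /eqP ->.
  rewrite leq_eqVlt => /predU1P[->//|ij].
  by apply: leq_trans (ltnW (nS j)); apply: IH.
pose good k x := q / 2 <= rho (fun w => half (n_ k) * p (n_ k) x w).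
pose s := fix s k := if k is l.+1 then
  if good l (s l + u (n_ l)) then s l + u (n_ l) else s l - u (n_ l) else 0.
have sS k : s k.+1 = s k + u (n_ k) \/ s k.+1 = s k - u (n_ k).
  by rewrite /=; case: ifP => _; [left|right].
(* If the sign plus fails, then [u + u = (s + u) - (s - u)] and [p u <= p (u + u)] leave at least
   [q / 2] for the sign minus. *)
have sgood k : good k (s k.+1).
  rewrite /=; case: ifPn => // /negP; rewrite /good => /negP; rewrite -ltNge => h.
  have := hq (n_ k); have := rho_ms_double (half (n_ k)) (u (n_ k)) (hp (n_ k)).
  have := rho_ms_tri (half (n_ k)) (u (n_ k) + u (n_ k)) (s k + u (n_ k)) (hp (n_ k)).
  have -> : u (n_ k) + u (n_ k) - (s k + u (n_ k)) = - (s k - u (n_ k)).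
    by rewrite opprB opprD addrACA subrr addr0.
  by rewrite (rho_msN (hp (n_ k))); lra.
have dS (F : S -> R) : (forall x, F (- x) = F x) -> forall k, F (s k.+1 - s k) = F (u (n_ k)).
  by move=> FN k; case: (sS k) => ->; rewrite addrAC subrr add0r.
have sC k j : rn (s (k + j)%N - s k) <= 2 * half k - 2 * half (k + j)%N.
  elim: j => [|j IH]; first by rewrite addn0 !subrr rn0.
  rewrite addnS; apply: le_trans (rn_tri M _ (s (k + j)%N) _) _.
  rewrite (dS rn) ?pow2VS; last exact: rnN.
  have := hu (n_ (k + j)%N); have := pow2V_anti (nk (k + j)%N); lra.
have [|y Hy] := @rn_complete_seq _ _ _ _ _ _ M s cM.
  move=> e e0; have e40 : 0 < e / 4 by lra.
  have [N HN] := pow2V_small e40; exists N.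
  have h m : (N <= m)%N -> rn (s m - s N) < e / 2.
    move=> Nm; have := sC N (m - N)%N; rewrite subnKC //.
    have := HN N (leqnn N); have := pow2V_gt0 m; lra.
  move=> m n /h hm /h hn; apply: le_lt_trans (rn_tri M _ (s N) _) _.
  by rewrite (rn_distC _ (s N)); lra.
exists s, n_, y; split => // k.
(* The increments after the hump are at most [half i * (q / 8)], a geometric series with sum at most
   [q / 4]: of the [q / 2] reached by [s k.+1], the limit keeps [q / 4]. *)
have tail j : rho (p (n_ k) (s (k.+1 + j)%N - s k.+1)) <=
    (2 * half k - 2 * half (k + j)%N) * (q / 8).
  have r1 x : rho (fun w => 1 * p (n_ k) x w) = rho (p (n_ k) x).
    by congr rho; apply/funext => w; rewrite mul1r.
  elim: j => [|j IH].
    rewrite !addn0 !subrr mul0r; apply: rho_bound => //.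
      exact: (ms_meas (hp _)).
    by apply: filterS (ms0 (hp (n_ k))) => w ->; rewrite normr0.
  rewrite addnS; have := rho_ms_tri 1 (s (k.+1 + j).+1 - s k.+1)
    (s (k.+1 + j)%N - s k.+1) (hp (n_ k)).
  rewrite !r1 opprB addrA subrK => /le_trans; apply.
  rewrite (dS (fun x => rho (p (n_ k) x))); last first.
    by move=> x; rewrite -!r1 (rho_msN (hp (n_ k))).
  have := @Hg (n_ (k + j)%N) (n_ (k.+1 + j)%N) (n_ k) (ngS _) (nmono _ _ (leq_addr _ _)).
  have := pow2V_anti (nk (k + j)%N); rewrite addnS pow2VS; nra.
apply/ler_addgt0Pl => e e0.
have [c c0 Hc] := ms_cont (hp (n_ k)) e0; have [N HN] := Hy _ c0.
have := HN (k.+1 + N)%N (leq_addl _ _); rewrite rn_distC => /Hc h1.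
have h2 := tail N; have h3 := sgood k; rewrite /good in h3.
have h4 := pow2V_gt0 (k + N)%N; have h5 := pow2V_le1 k.
have h01 : 0 <= half (n_ k) <= 1 by rewrite pow2V_le1 ltW // pow2V_gt0.
have h6 := rho_ms_tri (half (n_ k)) (s k.+1) y (hp (n_ k)).
have h7 := rho_ms_le (hp (n_ k)) (s k.+1 - y) h01.
have h8 := rho_msD (hp (n_ k)) 1 (s k.+1 - s (k.+1 + N)%N) (s (k.+1 + N)%N - y).
have r1 x : rho (fun w => 1 * p (n_ k) x w) = rho (p (n_ k) x).
  by congr rho; apply/funext => w; rewrite mul1r.
have sy x z : rho (p (n_ k) (x - z)) = rho (p (n_ k) (z - x)).
  by rewrite -!r1 -opprB (rho_msN (hp (n_ k))).
rewrite addrA subrK !r1 in h8; rewrite sy in h1; rewrite sy in h2.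
have h9 : (2 * half k - 2 * half (k + N)%N) * (q / 8) <= q / 4 by nra.
lra.
Qed.

End GlidingHump.

(** * C0-semigroups *)

Lemma subrACA (V : zmodType) (x y z t : V) : x - y - (z - t) = x - z - (y - t).
Proof. by rewrite !opprB addrACA [RHS]addrACA [X in _ = _ + X]addrC. Qed.

Section Semigroup.
Context {d : measure_display} {T : measurableType d} {R : realType}.
Variables (P : probability T R) (isC : bool) (S : zmodType).
Variable M : RNModule P isC S.
Variable Tt : R -> S -> S.
Hypotheses (cM : rn_complete M) (hT : C0_semigroup M Tt).
Implicit Types (x y z : S) (xi eta : T -> R).
Local Notation nrm := (rn_norm M).
Local Notation rho := (rho P).
Local Notation rn := (rn M).
Local Notation rscale := (rscale M).
Local Notation modsn := (modsn M).
Local Notation half n := ((2^-1 : R) ^+ n).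
#[local] Hint Resolve nrm_meas : core.

Lemma T_op t : 0 <= t -> rn_bounded_op M (Tt t).
Proof. by case: hT => h _; apply: h. Qed.

Lemma T_0 x : Tt 0 x = x. Proof. by case: hT => _ []. Qed.

Lemma T_add s t x : 0 <= s -> 0 <= t -> Tt s (Tt t x) = Tt (s + t) x.
Proof. by case: hT => _ [_ [h _]]; apply: h. Qed.

Lemma T_cont x e : 0 < e ->
  exists2 c, 0 < c & forall h, 0 <= h < c -> rn (Tt h x - x) < e.
Proof.
move=> e0; have [_ [_ [_ /(_ x) /rn_cvgP /(_ _ e0)]]] := hT.
case=> c /= c0 H; exists c => // h /andP[]; rewrite le_eqVlt => /predU1P[<- _|h0 hc].
  by rewrite T_0 subrr rn0.
by apply: H => //=; rewrite sub0r normrN gtr0_norm.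
Qed.

(** Right continuity follows from continuity at [0] and of the single operator [Tt t]. Left
    continuity would require equicontinuity; approximating times from the right avoids it. *)
Lemma T_rcont t x e : 0 <= t -> 0 < e ->
  exists2 c, 0 < c & forall h, 0 <= h < c -> rn (Tt (t + h) x - Tt t x) < e.
Proof.
move=> t0 e0; have [c1 c10 H1] := op_cont (T_op t0) e0.
have [c c0 H] := T_cont x c10; exists c => // h /andP[h0 hc].
rewrite -T_add // -(opB (T_op t0)); apply: H1; apply: H.
by rewrite h0.
Qed.

(** Otherwise a gliding hump yields a vector [y] and times [t_n] tending to [0] such that
    [half n * nrm (T(t_n) y)] has [rho] at least [e / 4] for arbitrarily large [n]. But [T(t_n) y]
    tends to [y] and [half n * nrm y] to [0]. *)
Lemma equicont_near0 e : 0 < e -> exists c tau, [/\ 0 < c, 0 < tau &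
  forall t x, 0 <= t <= tau -> rn x < c -> rn (Tt t x) < e].
Proof.
move=> e0; apply: contrapT => Hn.
(* The bound on the vector is a square: one factor [half n] pays for the multiplication by its
   inverse in [u], the other makes the series of the [u n] converge. *)
have /choice [tx Htx] : forall n : nat, exists tx : R * S,
    [/\ 0 <= tx.1 <= half n, rn tx.2 < half n * half n & e <= rn (Tt tx.1 tx.2)].
  move=> n; apply: contrapT => Hn'; apply: Hn.
  exists (half n * half n), (half n); split; rewrite ?mulr_gt0 ?pow2V_gt0 //.
  move=> t x ht hx; rewrite ltNge; apply/negP => h.
  by apply: Hn'; exists (t, x).
have t0 n : 0 <= (tx n).1 by have [/andP[]] := Htx n.
pose cn n : T -> R := fun _ => (half n)^-1.
have mcn n : measurable_fun setT (cn n) by exact: measurable_cst.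
pose u n := rscale (cn n) (tx n).2.
have hn0 n : 0 < half n := pow2V_gt0 n.
have hn1 n : 1 <= (half n)^-1 by rewrite invf_ge1 // pow2V_le1.
have [||n|s [n_ [y [_ _ nk _ Hy]]]] := @gliding_hump _ _ _ _ _ _ M
    (fun n x => nrm (Tt (tx n).1 x)) u e cM _ _ e0.
- by move=> n; apply: op_modsn; apply: T_op.
- move=> n; apply: le_trans (rn_cscale M _ _) _.
  rewrite ger0_norm ?invr_ge0 ?(ltW (hn0 n)) // max_r //.
  have [_ /ltW h _] := Htx n.
  by rewrite mulrC ler_pdivrMr.
- have [_ _ /le_trans] := Htx n; apply; apply: rho_le => //.
    exact: measurable_funM.
  rewrite /u (opZ (T_op (t0 n))) //.
  ae_with (nrmZ M (Tt (tx n).1 (tx n).2) (mcn n)); apply: aeW => w ->.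
  rewrite [`|cn n w|]ger0_norm ?invr_ge0 ?(ltW (hn0 n)) // mulrA mulfV ?mul1r ?gt_eqF //.
have e80 : 0 < e / 8 by lra.
have [c c0 Hc] := T_cont y e80.
have [c' /andP[c'0 _] Hc'] := rho_small P (nrm_meas M y) e80.
have [N1 HN1] := pow2V_small c0; have [N2 HN2] := pow2V_small c'0.
pose n := n_ (maxn N1 N2).
have h1 : half n < c by apply: HN1; apply: leq_trans (nk _); apply: leq_maxl.
have h2 : half n < c' by apply: HN2; apply: leq_trans (nk _); apply: leq_maxr.
have h3 : rn (Tt (tx n).1 y - y) < e / 8.
  apply: Hc; rewrite t0 /=; have [/andP[_ h] _ _] := Htx n.
  exact: le_lt_trans h h1.
have h4 : rho (fun w => half n * nrm y w) < e / 8.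
  by apply: Hc'; rewrite !ltW.
have := Hy (maxn N1 N2); rewrite -/n.
have := rho_ms_tri (half n) (Tt (tx n).1 y) y (nrm_modsn M).
have h01 : 0 <= half n <= 1 by rewrite pow2V_le1 ltW.
have := rho_ms_le (nrm_modsn M) (Tt (tx n).1 y - y) h01.
rewrite -/(rn _); lra.
Qed.

Lemma equicont B e : 0 < e -> exists2 c, 0 < c &
  forall t x, 0 <= t <= B -> rn x < c -> rn (Tt t x) < e.
Proof.
move=> e0; have [c1 [tau [c10 tau0 H1]]] := equicont_near0 e0.
have HK (K : nat) : exists2 c, 0 < c &
    forall t x, 0 <= t <= K%:R * tau -> rn x < c -> rn (Tt t x) < e.
  elim: K => [|K [c c0 Hc]].
    exists e => // t x; rewrite mul0r => h.
    have -> : t = 0 by apply/le_anti; rewrite andbC.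
    by rewrite T_0.
  have Kt : 0 <= K%:R * tau by rewrite mulr_ge0 // ltW.
  have [c2 c20 H2] := op_cont (T_op Kt) c10.
  exists (Num.min c c2); first by rewrite lt_min c0.
  move=> t x /andP[t0 tK]; rewrite lt_min => /andP[hc hc2].
  have [ht|/ltW ht] := leP t (K%:R * tau); first by apply: Hc => //; rewrite t0.
  have h0 : 0 <= t - K%:R * tau by rewrite subr_ge0.
  rewrite -(subrK (K%:R * tau) t) -T_add //; apply: H1; last exact: H2.
  by rewrite h0 /= lerBlDr; apply: le_trans tK _; rewrite -natr1 mulrDl mul1r addrC.
have [K hK] : exists K : nat, B <= K%:R * tau.
  exists (Num.bound `|B / tau|); rewrite -ler_pdivrMr //.
  by apply: le_trans (ler_norm _) _; apply/ltW/archi_boundP.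
have [c c0 Hc] := HK K; exists c => // t x /andP[t0 tB].
by apply: Hc; rewrite t0 (le_trans tB).
Qed.

(** * Dyadic times, orbit maxima on [[0, 2]] and bounds away from time [0] *)

Definition dyad k i : R := i%:R * half k.

Lemma dyad_ge0 k i : 0 <= dyad k i.
Proof. by rewrite /dyad mulr_ge0 // ltW // pow2V_gt0. Qed.

Lemma dyadS k i : dyad k.+1 (2 * i) = dyad k i.
Proof. by rewrite /dyad exprS natrM mulrACA mulfV ?mul1r // pnatr_eq0. Qed.

Lemma dyadD k i j : dyad k (i + j) = dyad k i + dyad k j.
Proof. by rewrite /dyad natrD mulrDl. Qed.

Lemma pow2V_nat k : (2 ^ k)%:R * half k = 1.
Proof. by rewrite natrX -exprMn mulfV ?expr1n // pnatr_eq0. Qed.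

Lemma dyad_le k i j : (i <= j)%N -> dyad k i <= dyad k j.
Proof. by move=> ij; rewrite /dyad ler_pM2r ?pow2V_gt0 // ler_nat. Qed.

Lemma dyad_full k a : dyad k (a * 2 ^ k) = a%:R.
Proof. by rewrite /dyad natrM -mulrA pow2V_nat mulr1. Qed.

Lemma dyad_half k m : dyad (k + m) (2 ^ k) = half m.
Proof. by rewrite /dyad exprD mulrA pow2V_nat mul1r. Qed.

(** Rounding up matches [T_rcont]. The condition [t < 2] leaves room to the right inside the grid of
    [[0, 2]]; the time [2] itself belongs to every grid. *)
Lemma dyadic_right t c : 0 <= t < 2 -> 0 < c -> exists k i,
  (i <= 2 ^ k.+1)%N /\ 0 <= dyad k i - t < c.
Proof.
move=> /andP[t0 t2] c0; have [k /(_ k (leqnn k)) hk] := pow2V_small c0.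
pose a := t * (2 ^ k)%:R; have a0 : 0 <= a by rewrite mulr_ge0.
have /andP[h1 h2] := truncn_itv a0.
have ta : t = a * half k by rewrite /a -mulrA pow2V_nat mulr1.
exists k, (Num.truncn a).+1; split.
  rewrite -(ltr_nat R); apply: le_lt_trans h1 _.
  by rewrite /a expnS natrM ltr_pM2r // ltr0n expn_gt0.
rewrite /dyad {1 2}ta -mulrBl mulr_ge0 ?subr_ge0 ?ltW // ?pow2V_gt0 //=.
apply: le_lt_trans hk; rewrite -[leRHS]mul1r ler_pM2r ?pow2V_gt0 //.
by rewrite -natr1; lra.
Qed.

(* maximum over the dyadic times of level [k] in [0, 2] *)
Definition dmax k : S -> T -> R :=
  maxsn (fun i x => nrm (Tt (dyad k i) x)) (2 ^ k.+1).+1.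

Lemma dmax_modsn k : modsn (dmax k).
Proof.
by apply: maxsn_modsn => i _; apply: op_modsn; apply: T_op; apply: dyad_ge0.
Qed.

Lemma dmax_ge k i x w : (i <= 2 ^ k.+1)%N -> nrm (Tt (dyad k i) x) w <= dmax k x w.
Proof.
by move=> h; apply: (@maxsn_ge _ _ _ _ (fun i x => nrm (Tt (dyad k i) x))).
Qed.

Lemma dmax_le k x w a : (forall i, (i <= 2 ^ k.+1)%N -> nrm (Tt (dyad k i) x) w <= a) ->
  dmax k x w <= a.
Proof. by move=> h; apply: maxsn_le => // i; rewrite ltnS; apply: h. Qed.

Lemma dmaxS k x w : dmax k x w <= dmax k.+1 x w.
Proof.
apply: dmax_le => i h; rewrite -dyadS; apply: dmax_ge.
by rewrite expnS leq_mul2l.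
Qed.

Lemma dmax_mono k l x w : (k <= l)%N -> dmax k x w <= dmax l x w.
Proof.
elim: l => [|l IH]; first by rewrite leqn0 => /eqP ->.
by rewrite leq_eqVlt => /predU1P[->//|kl]; apply: le_trans (dmaxS _ _ _); apply: IH.
Qed.

Lemma dmax_ae_le k x (G : T -> R) :
  (forall t, 0 <= t <= 2 -> {ae P, forall w, nrm (Tt t x) w <= G w}) ->
  {ae P, forall w, dmax k x w <= G w}.
Proof.
move=> H.
have /ae_foralln : forall i, {ae P, forall w,
    (i <= 2 ^ k.+1)%N -> nrm (Tt (dyad k i) x) w <= G w}.
  move=> i; have [hi|hi] := boolP (i <= 2 ^ k.+1)%N; last by apply: aeW.
  apply: filterS (H (dyad k i) _) => [w h _ //|].
  rewrite dyad_ge0 /=; have := dyad_le k hi.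
  by rewrite expnS dyad_full.
by apply: filterS => w h; apply: dmax_le.
Qed.

(** [Tt t x] is the limit in probability of values of the orbit at dyadic times to the right of [t],
    and the bound [G] is common to all grids. *)
Lemma bound_of_dmax x (G : T -> R) : measurable_fun setT G ->
  (forall k, {ae P, forall w, dmax k x w <= G w}) ->
  forall t, 0 <= t <= 2 -> {ae P, forall w, nrm (Tt t x) w <= G w}.
Proof.
move=> mG H t /andP[t0]; rewrite le_eqVlt => /predU1P[->|t2].
  apply: filterS (H 0%N) => w; apply: le_trans.
  by have := @dmax_ge 0 2 x w erefl; rewrite -[2%N]muln1 dyad_full.
have /choice [ki Hki] : forall n, exists ki : nat * nat, (ki.2 <= 2 ^ ki.1.+1)%N /\
    rn (Tt t x - Tt (dyad ki.1 ki.2) x) < half n.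
  move=> n; have [c c0 Hc] := T_rcont x t0 (pow2V_gt0 n).
  have [|k [i [h1 h2]]] := @dyadic_right t c _ c0; first by rewrite t0.
  exists (k, i); split => //=; rewrite rn_distC.
  by have := Hc _ h2; rewrite (addrC t) subrK.
apply: (@le_of_rho_small _ _ _ P (nrm (Tt t x)) G
  (fun n => nrm (Tt t x - Tt (dyad (ki n).1 (ki n).2) x))) => //.
  move=> e e0; have [N /(_ N (leqnn N)) h] := pow2V_small e0.
  by exists N; apply: lt_trans h; have [] := Hki N.
move=> n; ae_with (H (ki n).1).
ae_with (nrm_sub M (Tt t x) (Tt (dyad (ki n).1 (ki n).2) x)); apply: aeW => w.
have [/(@dmax_ge _ _ x w) h _] := Hki n; lra.
Qed.

Lemma norm_family : exists N : R -> T -> R, forall t, 0 <= t ->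
  [/\ measurable_fun setT (N t),
      forall x, {ae P, forall w, nrm (Tt t x) w <= N t w * nrm x w},
      forall H, measurable_fun setT H ->
        (forall x, in_ball M x -> {ae P, forall w, nrm (Tt t x) w <= H w}) ->
        {ae P, forall w, N t w <= H w},
      forall c e, (forall x, in_ball M x -> rho (fun w => c * nrm (Tt t x) w) <= e) ->
        rho (fun w => c * N t w) <= e &
      {ae P, forall w, 0 <= N t w}].
Proof.
have /choice [N HN] : forall t, exists N : T -> R, 0 <= t ->
  [/\ measurable_fun setT N,
      forall x, {ae P, forall w, nrm (Tt t x) w <= N w * nrm x w},
      forall H, measurable_fun setT H ->
        (forall x, in_ball M x -> {ae P, forall w, nrm (Tt t x) w <= H w}) ->
        {ae P, forall w, N w <= H w},
      forall c e, (forall x, in_ball M x -> rho (fun w => c * nrm (Tt t x) w) <= e) ->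
        rho (fun w => c * N w) <= e &
      {ae P, forall w, 0 <= N w}].
  move=> t; have [t0|t0] := boolP (0 <= t); last by exists (cst 0).
  by have [N HN] := ms_opnorm (op_modsn (T_op t0)); exists N.
by exists N.
Qed.

(** Equicontinuity applied to [(c / 2) x], with [x] in the unit ball, gives a bound uniform over the
    ball, which passes to the norms: they are bounded in probability uniformly in time. *)
Lemma norm_family_small (N : R -> T -> R) B :
  (forall t, 0 <= t -> forall c e,
     (forall x, in_ball M x -> rho (fun w => c * nrm (Tt t x) w) <= e) ->
     rho (fun w => c * N t w) <= e) ->
  forall e, 0 < e -> exists2 c, 0 < c &
    forall t, 0 <= t <= B -> rho (fun w => c * N t w) <= e.
Proof.
move=> HN e e0; have [c c0 Hc] := equicont B e0.
have c20 : 0 < c / 2 by lra.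
have mc : measurable_fun setT (fun _ : T => c / 2) by exact: measurable_cst.
exists (c / 2) => // t /andP[t0 tB]; apply: HN => // x hx; apply/ltW.
apply: le_lt_trans (Hc t (rscale (fun _ => c / 2) x) _ _); rewrite ?t0 //.
  rewrite (opZ (T_op t0)) //; apply: rho_le => //; first exact: measurable_funM.
  by apply: filterS (nrmZ M (Tt t x) mc) => w ->; rewrite normrM [leRHS]normrM normr_id.
apply: (@le_lt_trans _ _ (c / 2)); last by lra.
apply: rho_bound => //; first exact: ltW.
ae_with hx; ae_with (nrmZ M x mc); ae_with (nrm_ge0 M x); apply: aeW => w h0 -> h.
by rewrite normrM normr_id (gtr0_norm c20) (ger0_norm h0) ler_piMr // ltW.
Qed.

Lemma rho_sum (I : Type) (r : seq I) (c e : R) (f : I -> T -> R) : 0 <= c ->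
  (forall i, measurable_fun setT (f i)) -> (forall i, rho (f i) <= e) ->
  measurable_fun setT (fun w => \sum_(i <- r) c * clip (f i) w) /\
  rho (fun w => \sum_(i <- r) c * clip (f i) w) <= (size r)%:R * (c * e).
Proof.
move=> c0 mf fe; elim: r => [|a r [IHm IH]].
  rewrite (_ : (fun _ => _) = (fun _ => 0)); last first.
    by apply/funext => w; rewrite big_nil.
  by split; [exact: measurable_cst|rewrite mul0r rho_cst // lexx ler01].
rewrite (_ : (fun _ => _) = (fun w => c * clip (f a) w +
    \sum_(i <- r) c * clip (f i) w)); last first.
  by apply/funext => w; rewrite big_cons.
have mc : measurable_fun setT (fun w => c * clip (f a) w).
  by apply: measurable_funM => //; apply: measurable_clip.
split; first exact: measurable_funD.
apply: (@le_trans _ _ (c * e + (size r)%:R * (c * e))); last first.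
  by rewrite /= -natr1 mulrDl mul1r addrC.
apply: (@le_trans _ _ (rho (fun w => c * clip (f a) w) +
    rho (fun w => \sum_(i <- r) c * clip (f i) w))).
  apply: rho_add => //; first exact: measurable_funD.
  by apply: aeW => w; apply: ler_normD.
apply: lerD => //; apply: le_trans (rho_mul_clip _ _ _) _ => //.
by rewrite ler_wpM2l.
Qed.

(* If fewer than half of the indices [j <= l] are bad, some [j] and its mirror
   image [l - j] are both good. *)
Lemma mirror_pigeonhole (l : nat) (f : nat -> R) : (forall j, 0 <= f j) ->
  \sum_(j < l.+1) f j < l.+1%:R / 2 ->
  exists j, [/\ (j <= l)%N, f j < 1 & f (l - j)%N < 1].
Proof.
move=> f0 hs; apply: contrapT => Hn.
have h : l.+1%:R <= \sum_(j < l.+1) (f j + f (l - j)%N).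
  rewrite -[leLHS]mulr1n -[X in X%:R](card_ord l.+1) -sumr_const.
  apply: ler_sum => j _; rewrite leNgt; apply/negP => hj; apply: Hn.
  have := f0 j; have := f0 (l - j)%N.
  by exists j; split; [rewrite -ltnS|lra|lra].
move: h; rewrite big_split /= (reindex_inj rev_ord_inj) /=.
have -> : \sum_(j < l.+1) f (l.+1 - j.+1)%N = \sum_(j < l.+1) f (l - j)%N.
  by apply: eq_bigr => j _; rewrite subSS.
have -> : \sum_(j < l.+1) f (l - j)%N = \sum_(j < l.+1) f j.
  rewrite [RHS](reindex_inj rev_ord_inj) /=.
  by apply: eq_bigr => j _; rewrite subSS.
lra.
Qed.

(* Hille's argument on subadditive functions, on the dyadic grid: the orbit is
   bounded away from time [0] because [||T(t)|| <= ||T(s)|| ||T(t - s)||] for all [s]. *)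
Lemma hille m z : exists2 G : T -> R, measurable_fun setT G &
  forall k, {ae P, forall w, dmax k (Tt (half m) z) w <= G w}.
Proof.
have hm0 : 0 <= half m by rewrite ltW // pow2V_gt0.
have [N HN] := norm_family.
have mN t : 0 <= t -> measurable_fun setT (N t) by move=> /HN[].
(* [3] bounds every time [s + half m] with [s <= 2]. *)
have small := @norm_family_small N 3 (fun t t0 => let: And5 _ _ _ h _ := HN t t0 in h).
pose z' := Tt (half m) z.
(* The level is raised to [k + m] so that the starting time [half m] is itself a grid point, of
   index [2 ^ k]. *)
have [|||e e0|G [mG leG _ _]] := @ae_increasing_sup _ _ _ P (fun k => dmax (k + m) z').
- by move=> k; apply: (ms_meas (dmax_modsn _)).
- by move=> k; apply: (ms_ge0 (dmax_modsn _)).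
- by move=> k; apply: aeW => w; rewrite addSn; apply: dmaxS.
(* The sum [h] below has at most [4 * 2 ^ (k + m)] terms of weight [2 * half k], so [16 = 2 ^ 4] in
   [eta] bounds its [rho] by [e / 2], independently of [k]. *)
- pose eta := e * half (m + 4).
  have eta0 : 0 < eta by rewrite mulr_gt0 ?pow2V_gt0.
  have [c c0 Hc] := small _ eta0.
  have e20 : 0 < e / 2 by lra.
  have [c' /andP[c'0 _] Hc'] := rho_small P (nrm_meas M z) e20.
  exists (c' * (c * c)); first by rewrite !mulr_gt0.
  move=> k; pose F j := fun w => c * N (dyad (k + m) j) w.
  have mF j : measurable_fun setT (F j).
    by apply: measurable_funM => //; apply: mN; apply: dyad_ge0.
  (* Beyond time [3] no bound is available, and [rho_sum] asks for one at every index. *)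
  pose F' j := if (j <= 3 * 2 ^ (k + m))%N then F j else cst 0.
  have mF' j : measurable_fun setT (F' j).
    by rewrite /F'; case: ifP => _ //; exact: measurable_cst.
  have F'e j : rho (F' j) <= eta.
    rewrite /F'; case: ifP => hj; last by rewrite rho_cst ?lexx ?ler01 // ltW.
    by apply: Hc; rewrite dyad_ge0 -(dyad_full (k + m) 3) dyad_le.
  have h2k0 : 0 <= 2 * half k by rewrite mulr_ge0 // ltW // pow2V_gt0.
  (* The weight [2 * half k] is such that [h w < 1] puts the sum of [clip (F j) w] below
     [2 ^ k / 2]. As [l >= 2 ^ k], this is the hypothesis of [mirror_pigeonhole]. Where [h w >= 1],
     the clipped [h] alone dominates. *)
  have [mh rh] := rho_sum (index_iota 0 (3 * 2 ^ (k + m)).+1) h2k0 mF' F'e.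
  set h := (fun w => \sum_(_ <- _) _) in mh rh.
  have {}rh : rho h <= e / 2.
    apply: le_trans rh _; rewrite size_iota subn0.
    apply: (@le_trans _ _ ((4 * 2 ^ (k + m))%:R * (2 * half k * eta))).
      apply: ler_wpM2r; first by rewrite (mulr_ge0 h2k0) // ltW.
      by rewrite ler_nat ltn_mul2r expn_gt0.
    rewrite /eta !expnD !natrM !exprD.
    have Ek := pow2V_nat k; have Em := pow2V_nat m.
    have -> : half 4 = 16^-1 by rewrite exprVn -natrX.
    have -> : 4%:R * ((2 ^ k)%:R * (2 ^ m)%:R) * (2 * half k * (e * (half m * 16^-1))) =
       ((2 ^ k)%:R * half k) * ((2 ^ m)%:R * half m) * (4%:R * 2 * e * 16^-1) :> R.
      by ring.
    by rewrite Ek Em; lra.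
  have mcd : measurable_fun setT (fun w => c' * nrm z w) by exact: measurable_funM.
  have m1 : measurable_fun setT (fun w => c' * (c * c) * dmax (k + m) z' w).
    by apply: measurable_funM => //; apply: (ms_meas (dmax_modsn _)).
  have h1 : rho (fun w => c' * nrm z w) < e / 2 by apply: Hc'; rewrite lexx ltW.
  suff : rho (fun w => c' * (c * c) * dmax (k + m) z' w) <=
      rho (fun w => c' * nrm z w) + rho h by lra.
  have := @rho_lin _ _ _ P 1 0 1 1 _ _ _ _ ler01 (lexx 0) ler01 ler01 m1 m1 mcd mh.
  rewrite !mul1r mul0r addr0; apply.
  have key : {ae P, forall w, forall l j, (j <= l)%N ->
      nrm (Tt (dyad (k + m) l) z) w <=
      N (dyad (k + m) j) w * (N (dyad (k + m) (l - j)) w * nrm z w)}.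
    apply: ae_foralln => l; apply: ae_foralln => j.
    have [jl|jl] := boolP (j <= l)%N; last exact: aeW.
    have [_ H1 _ _ N0] := HN _ (dyad_ge0 (k + m) j).
    have [_ H2 _ _ _] := HN _ (dyad_ge0 (k + m) (l - j)).
    ae_with (H1 (Tt (dyad (k + m) (l - j)) z)); ae_with (H2 z); ae_with N0.
    apply: aeW => w n0 h3 h4 _; rewrite T_add ?dyad_ge0 // -dyadD subnKC // in h4.
    by apply: le_trans h4 _; rewrite ler_wpM2l.
  have N0 : {ae P, forall w, forall j, 0 <= N (dyad (k + m) j) w}.
    by apply: ae_foralln => j; have [] := HN _ (dyad_ge0 (k + m) j).
  ae_with key; ae_with N0; ae_with (nrm_ge0 M z); ae_with (ms_ge0 (dmax_modsn (k + m)) z').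
  apply: aeW => w d0 z0 {}N0 {}key; rewrite !mul1r mul0r addr0.
  have [h1w|h1w] := leP 1 (h w).
    rewrite -[leLHS]add0r; apply: lerD; first exact: clip_ge0.
    apply: le_trans (clip_le1 _ _) _.
    by rewrite /clip ger0_norm ?min_l // (le_trans _ h1w).
  rewrite -[leLHS]addr0; apply: lerD; last exact: clip_ge0.
  apply: clip_mono; rewrite !ger0_norm; last 2 first.
  + by rewrite mulr_ge0 // ltW.
  + by rewrite !mulr_ge0 // ltW.
  rewrite -mulrA ler_pM2l // mulrC -ler_pdivlMr ?mulr_gt0 //.
  apply: dmax_le => i hi; rewrite /z' T_add ?dyad_ge0 // -(dyad_half k m) -dyadD.
  set l := (i + 2 ^ k)%N.
  have hl : (l <= 3 * 2 ^ (k + m))%N.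
    rewrite [leqRHS]mulSn [leqRHS]addnC; apply: leq_add; first by rewrite -expnS.
    by rewrite leq_exp2l // leq_addr.
  have [||j [jl a b]] := @mirror_pigeonhole l (fun j => clip (F j) w).
  + by move=> j; apply: clip_ge0.
  + have hh : \sum_(j < l.+1) 2 * half k * clip (F j) w <= h w.
      rewrite /h -(big_mkord xpredT (fun j => 2 * half k * clip (F j) w)).
      rewrite [leRHS](@big_cat_nat _ _ _ l.+1) //=.
      rewrite -[leLHS]addr0; apply: lerD; last first.
        by apply: sumr_ge0 => j _; rewrite mulr_ge0 // clip_ge0.
      rewrite le_eqVlt; apply/orP; left; apply/eqP.
      apply: eq_big_nat => j /andP[_ jl]; rewrite /F' ifT //.
      by apply: leq_trans hl; rewrite -ltnS.
    have lk : half k * l.+1%:R >= 1.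
      rewrite -[leLHS](pow2V_nat k) [leRHS]mulrC ler_pM2r ?pow2V_gt0 // ler_nat /l.
      by rewrite ltnW // ltnS leq_addl.
    rewrite -mulr_sumr in hh; have : 0 < half k := pow2V_gt0 k.
    move: (half k) (l.+1%:R) (\sum_(j < _) _) lk hh h1w => A B C; nra.
  apply: le_trans (key l j jl) _.
  have Fc j' : clip (F j') w < 1 -> N (dyad (k + m) j') w <= c^-1.
    rewrite /clip /F ger0_norm ?mulr_ge0 ?(ltW c0) // minElt; case: ifP => //.
      by rewrite ltxx.
    by move=> _ /ltW; rewrite -ler_pdivlMl // mulr1.
  rewrite mulrA mulrC ler_wpM2l // invfM.
  by apply: ler_pM => //; apply: Fc.
exists G => // k; apply: filterS (leG k) => w; apply: le_trans.
by apply: dmax_mono; apply: leq_addr.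
Qed.

(** * Estimates in mean and integrals of orbits *)

Local Notation cs r := (rscale (fun _ => r)).
Local Notation L1 x c := (L1le P (nrm x) c).

Lemma mcst (r : R) : measurable_fun setT (fun _ : T => r).
Proof. exact: measurable_cst. Qed.
#[local] Hint Resolve mcst : core.

Lemma csM r s x : cs (r * s) x = cs r (cs s x).
Proof. by rewrite -rscaleA. Qed.

Lemma csB r s x : cs (r - s) x = cs r x - cs s x.
Proof.
rewrite rscaleDl //; congr (_ + _); rewrite -(rscaleN1 M) -csM.
by congr rscale; apply/funext => w; rewrite mulN1r.
Qed.

Lemma cs_nat n x : cs n%:R x = x *+ n.
Proof.
elim: n => [|n IH]; first by rewrite rscale0.
rewrite [RHS]mulrS -IH -{2}(rscale1 M x) -rscaleDl //.
by congr rscale; apply/funext => w; rewrite [LHS]mulrS.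
Qed.

Lemma L1D x y a b : L1 x a -> L1 y b -> L1 (x + y) (a + b).
Proof.
apply: L1le_add => //.
ae_with (nrmD M x y); ae_with (nrm_ge0 M x); ae_with (nrm_ge0 M y).
ae_with (nrm_ge0 M (x + y)); apply: aeW => w h1 h2 h3 h4.
by rewrite !ger0_norm.
Qed.

Lemma L1N x a : L1 x a -> L1 (- x) a.
Proof. by apply: L1le_ae => //; apply: filterS (nrmN M x) => w ->. Qed.

Lemma L1B x y a b : L1 x a -> L1 y b -> L1 (x - y) (a + b).
Proof. by move=> hx hy; apply: L1D => //; apply: L1N. Qed.

Lemma L1_0 : L1 0 0.
Proof.
by apply: L1le_ae (L1le0 P) => //; apply: filterS (nrm0 M) => w ->; rewrite normr0.
Qed.

Lemma L1Z r x a : L1 x a -> L1 (cs r x) (`|r| * a).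
Proof.
move=> h; have := L1le_scale r (nrm_meas M x) h.
apply: L1le_ae => //; first exact: measurable_funM.
by apply: filterS (nrmZ M x (mcst r)) => w ->; rewrite normrM [leRHS]normrM normr_id.
Qed.

Lemma L1_rn x a : L1 x a -> rn x <= a.
Proof. exact: L1le_rho. Qed.

Lemma L1_sum (I : eqType) (l : seq I) (f : I -> S) a :
  (forall i, i \in l -> L1 (f i) a) -> L1 (\sum_(i <- l) f i) ((size l)%:R * a).
Proof.
elim: l => [|i l IH] H; first by rewrite big_nil mul0r; apply: L1_0.
rewrite big_cons /= -nat1r mulrDl mul1r; apply: L1D.
  by apply: H; rewrite mem_head.
by apply: IH => j jl; apply: H; rewrite in_cons jl orbT.
Qed.

Lemma L1_lim x a :
  (forall e, 0 < e -> exists2 y, L1 y (a + e) & rn (x - y) < e) -> L1 x a.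
Proof.
move=> H; apply: L1le_closed => // e e0; have [y hy hxy] := H e e0.
exists (nrm y), (nrm (x - y)); split => //.
have := nrmD M y (x - y); rewrite addrC subrK; apply: filter_app.
ae_with (nrm_ge0 M x); ae_with (nrm_ge0 M y); ae_with (nrm_ge0 M (x - y)).
by apply: aeW => w h1 h2 h3 h4; rewrite !ger0_norm.
Qed.

(** Right continuity in mean of the orbit, uniform over the interval of integration [[0, 1]]; the
    increment of the orbit at [s] is written as [Tt s] of its increment at [0]. *)
Definition mean_cont y := forall e, 0 < e -> exists2 c, 0 < c &
  forall s h, 0 <= s <= 1 -> 0 <= h <= c -> L1 (Tt s (Tt h y - y)) e.

Lemma sum_blocks n m (f : nat -> S) :
  \sum_(0 <= i < n * m) f i = \sum_(0 <= a < n) \sum_(0 <= b < m) f (a * m + b)%N.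
Proof.
elim: n => [|n IH]; first by rewrite mul0n !big_geq.
rewrite big_nat_recr //= -IH (@big_cat_nat _ _ _ (n * m)) //=; last first.
  by rewrite leq_mul2r leqnSn orbT.
congr (_ + _); rewrite -{1}[(n * m)%N]add0n big_addn mulSn addnK.
by apply: eq_big_nat => i _; rewrite addnC.
Qed.

(** Discrete form of the identity between the integral over [[t, t + 1]] minus that over [[0, 1]]
    and the integral over [[1, 1 + t]] minus that over [[0, t]]: both add up the same range of
    [n + m] indices. *)
Lemma sum_shift n m (f : nat -> S) :
  \sum_(0 <= i < n) f (i + m)%N - \sum_(0 <= i < n) f i =
  \sum_(0 <= i < m) (f (i + n)%N - f i).
Proof.
have H a b : \sum_(0 <= i < a + b) f i = \sum_(0 <= i < a) f i + \sum_(0 <= i < b) f (i + a)%N.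
  rewrite (@big_cat_nat _ _ _ a) //= ?leq_addr //; congr (_ + _).
  by rewrite -{1}[a]add0n big_addn addKn.
rewrite big_split /= sumrN; apply/eqP; rewrite subr_eq addrAC eq_sym subr_eq.
by rewrite [X in X == _]addrC -H [X in _ == X]addrC -H addnC.
Qed.

Lemma T_sum t (I : Type) (l : seq I) (f : I -> S) : 0 <= t ->
  Tt t (\sum_(i <- l) f i) = \sum_(i <- l) Tt t (f i).
Proof.
move=> t0; elim: l => [|a l IH]; first by rewrite !big_nil (op0 (T_op t0)).
by rewrite !big_cons (opD (T_op t0)) IH.
Qed.

(** Left Riemann sum of the integral of the orbit of [y] over [[0, 1]]. *)
Definition riem k y := cs (half k) (\sum_(0 <= i < 2 ^ k) Tt (dyad k i) y).

Lemma L1_avg l n e (f : nat -> S) : 0 <= e ->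
  (forall i, (i < n)%N -> L1 (f i) e) ->
  L1 (cs (half l) (\sum_(0 <= i < n) f i)) (dyad l n * e).
Proof.
move=> e0 H; rewrite /dyad (mulrC n%:R) -mulrA -(@gtr0_norm _ (half l)) ?pow2V_gt0 //.
have hl : `|(2^-1 : R) ^+ l| = half l by rewrite gtr0_norm ?pow2V_gt0.
rewrite {1}hl; apply: L1Z.
have := @L1_sum _ (index_iota 0 n) f e; rewrite size_iota subn0; apply => i.
by rewrite mem_index_iota; apply: H.
Qed.

(** Each coarse value is compared with the [2 ^ j] fine values of its cell, which lie less than
    [half k] to its right. Averaging keeps a bound in mean, as it would not keep one on [rho]. *)
Lemma riem_cauchy y e k j c : 0 <= e -> half k <= c ->
  (forall s h, 0 <= s <= 1 -> 0 <= h <= c -> L1 (Tt s (Tt h y - y)) e) ->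
  L1 (riem (k + j) y - riem k y) e.
Proof.
move=> e0 hk H.
have -> : riem (k + j) y - riem k y = cs (half (k + j))
    (\sum_(0 <= a < 2 ^ k) \sum_(0 <= b < 2 ^ j)
       Tt (dyad k a) (Tt (dyad (k + j) b) y - y)).
  have E : half k = half (k + j) * (2 ^ j)%:R.
    by rewrite exprD -mulrA (mulrC (half j)) pow2V_nat mulr1.
  rewrite /riem E csM cs_nat -rscaleB // expnD sum_blocks; congr rscale.
  rewrite -sumrMnl -sumrB; apply: eq_bigr => a _.
  rewrite -[X in _ - _ *+ X]subn0 -sumr_const_nat.
  rewrite -sumrB; apply: eq_bigr => b _.
  rewrite (opB (T_op (dyad_ge0 _ _))) T_add ?dyad_ge0 // dyadD; congr (Tt (_ + _) _ - _).
  by rewrite /dyad natrM exprD mulrACA pow2V_nat mulr1.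
have h1 : half (k + j) * ((2 ^ k)%:R * ((2 ^ j)%:R * e)) = e.
  have Ek := pow2V_nat k; have Ej := pow2V_nat j; rewrite exprD.
  move: ((2 ^ k)%:R : R) ((2 ^ j)%:R : R) (half k) (half j) Ek Ej => a b u v ua vb.
  have -> : u * v * (a * (b * e)) = a * u * (b * v) * e by ring.
  by rewrite ua vb !mul1r.
rewrite -[X in L1 _ X]h1 -[X in X * _]gtr0_norm ?pow2V_gt0 //; apply: L1Z.
have := @L1_sum _ (index_iota 0 (2 ^ k)); rewrite size_iota subn0; apply.
move=> a; rewrite mem_index_iota => /andP[_ ha].
have := @L1_sum _ (index_iota 0 (2 ^ j)); rewrite size_iota subn0; apply.
move=> b; rewrite mem_index_iota => /andP[_ hb].
apply: H; rewrite dyad_ge0 /=.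
  by have := dyad_le k (ltnW ha); rewrite -[(2 ^ k)%N]mul1n dyad_full.
apply: le_trans hk; have := dyad_le (k + j) (ltnW hb).
by rewrite addnC dyad_half.
Qed.

Lemma riem_lim y : mean_cont y ->
  exists x, forall e, 0 < e -> exists N, forall n, (N <= n)%N -> rn (riem n y - x) < e.
Proof.
move=> hy; apply: rn_complete_seq => // e e0; have e30 : 0 < e / 3 by lra.
have [c c0 Hc] := hy _ e30; have [N /(_ N (leqnn N)) HN] := pow2V_small c0.
exists N; have h m : (N <= m)%N -> rn (riem m y - riem N y) <= e / 3.
  move=> Nm; apply: L1_rn; rewrite -(subnKC Nm).
  by apply: riem_cauchy Hc; exact: ltW.
move=> m n /h hm /h hn; apply: le_lt_trans (rn_tri M _ (riem N y) _) _.
by rewrite (rn_distC M (riem N y)); lra.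
Qed.

(** The identity [T(t) x - x = \int_0^t T(s) (T(1) y - y) ds] already holds exactly for Riemann
    sums, because [t] and [1] are both multiples of the mesh. *)
Lemma riem_step y l j : Tt (dyad l j) (riem l y) - riem l y =
  cs (half l) (\sum_(0 <= i < j) Tt (dyad l i) (Tt 1 y - y)).
Proof.
rewrite /riem (opZ (T_op (dyad_ge0 _ _))) // -rscaleB //; congr rscale.
rewrite T_sum ?dyad_ge0 //.
under eq_bigr do rewrite T_add ?dyad_ge0 // -dyadD addnC.
rewrite (sum_shift _ _ (fun i => Tt (dyad l i) y)); apply: eq_bigr => i _.
rewrite (opB (T_op (dyad_ge0 _ _))) T_add ?dyad_ge0 // dyadD.
by rewrite -[(2 ^ l)%N]mul1n dyad_full.
Qed.

(** The error is bounded in mean by [e * t], and homogeneity of [L1le] survives the division by [t].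
    The bound is proved for dyadic [t] by Riemann sums, then for all [t] by right continuity. *)
Lemma generator_riem y x : mean_cont y ->
  (forall e, 0 < e -> exists N, forall n, (N <= n)%N -> rn (riem n y - x) < e) ->
  generator M Tt x (Tt 1 y - y).
Proof.
move=> hy hx; set y' := Tt 1 y - y.
have main e : 0 < e -> exists2 c, 0 < c <= 1 & forall t, 0 < t < c ->
    L1 (Tt t x - x - cs t y') (e * t).
  move=> e0; have e20 : 0 < e / 2 by lra.
  have [c0 c00 Hc0] := hy _ e20; pose c := Num.min c0 1.
  have c1 : c <= 1 by rewrite ge_min lexx orbT.
  have cc0 : c <= c0 by rewrite ge_min lexx.
  exists c; first by rewrite lt_min c00 ltr01.
  have Hy' h : 0 <= h <= c -> L1 (Tt h y' - y') e.
    move=> /andP[h0 hc].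
    (* The increment of the orbit of [y'] splits into increments of the orbit of [y] at times [1]
       and [0], both in the range of [mean_cont]; each costs [e / 2]. *)
    have -> : Tt h y' - y' = Tt 1 (Tt h y - y) - Tt 0 (Tt h y - y).
      rewrite T_0 (opB (T_op ler01)) /y' (opB (T_op h0)) !T_add // (addrC h).
      exact: subrACA.
    have := @L1B (Tt 1 (Tt h y - y)) (Tt 0 (Tt h y - y)) (e / 2) (e / 2).
    rewrite -splitr; apply; apply: Hc0; rewrite ?h0 ?lexx ?ler01 //=;
      exact: le_trans cc0.
  have dy k j : dyad k j <= c ->
      L1 (Tt (dyad k j) x - x - cs (dyad k j) y') (e * dyad k j).
    move=> hc; set t := dyad k j; have t0 : 0 <= t by exact: dyad_ge0.
    apply: L1_lim => r r0.
    have r20 : 0 < r / 2 by lra.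
    have [c2 c20 H2] := op_cont (T_op t0) r20.
    pose mm := Num.min c2 (r / 2).
    have mm0 : 0 < mm by rewrite lt_min c20.
    have [N HN] := hx _ mm0.
    (* A level beyond [N] that refines level [k], so that [t] remains a grid point. *)
    pose l := (N + k)%N; pose jl := (2 ^ N * j)%N.
    have tl : t = dyad l jl.
      by rewrite /t /dyad natrM exprD mulrACA pow2V_nat mul1r.
    exists (Tt t (riem l y) - riem l y - cs t y').
      apply: (@L1le_mono _ _ _ _ _ (e * t)); first by lra.
      rewrite {1}tl riem_step {1}tl /dyad (mulrC jl%:R) csM cs_nat -rscaleB //.
      have -> : y' *+ jl = \sum_(0 <= i < jl) y' by rewrite sumr_const_nat subn0.
      rewrite -sumrB mulrC tl.
      apply: L1_avg; first exact: ltW.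
      move=> i ij; apply: Hy'; rewrite dyad_ge0 /=.
      by apply: le_trans (dyad_le _ (ltnW ij)) _; rewrite -tl.
    have : rn (riem l y - x) < mm by apply: HN; exact: leq_addr.
    rewrite lt_min => /andP[h1 h2].
    have -> : Tt t x - x - cs t y' - (Tt t (riem l y) - riem l y - cs t y') =
       (riem l y - x) - Tt t (riem l y - x).
      rewrite (opB (T_op t0)) [X in _ + X]opprB addrA subrK subrACA.
      by rewrite [LHS]addrC opprB; congr (_ + _); rewrite opprB.
    apply: le_lt_trans (rnB M _ _) _; have := H2 _ h1; lra.
  move=> t /andP[t0 tc]; apply: L1_lim => r r0.
  have r20 : 0 < r / 2 by lra.
  have [c1' c10 H1] := T_rcont x (ltW t0) r20.
  have [c2 /andP[c20 _] H2] := rho_small P (nrm_meas M y') r20.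
  (* The four bounds on [s - t] serve, in order: continuity of the orbit of [x], smallness of
     [(s - t) y'], keeping [s] below [c], and [e * s <= e * t + r]. *)
  pose mm := Num.min (Num.min c1' c2) (Num.min (c - t) (r / e)).
  have mm0 : 0 < mm by rewrite !lt_min c10 c20 subr_gt0 tc divr_gt0.
  have [|k [i [_ hd]]] := @dyadic_right t mm _ mm0.
    by rewrite ltW //= (lt_le_trans tc) // (le_trans c1) // ler1n.
  move: hd; rewrite !lt_min => /and3P[hd0 /andP[hd1 hd2] /andP[hd3 hd4]].
  set s := dyad k i in hd0 hd1 hd2 hd3 hd4 *.
  exists (Tt s x - x - cs s y').
    apply: (@L1le_mono _ _ _ _ _ (e * s)); last by apply: dy; rewrite -/s; lra.
    move: hd4; rewrite ltr_pdivlMr // => hd4; nra.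
  have -> : Tt t x - x - cs t y' - (Tt s x - x - cs s y') =
      cs (s - t) y' - (Tt s x - Tt t x).
    rewrite csB subrACA [X in X - _ = _]subrACA subrr subr0 [LHS]addrC opprB.
    by congr (_ + _); rewrite opprB.
  apply: le_lt_trans (rnB M _ _) _.
  have h1 : rn (Tt s x - Tt t x) < r / 2.
    by have := H1 (s - t); rewrite (addrC t) subrK; apply; rewrite hd0.
  have h2 : rn (cs (s - t) y') < r / 2.
    apply: le_lt_trans (H2 (s - t) _); last by rewrite hd0 ltW.
    apply: rho_le => //; first exact: measurable_funM.
    by apply: filterS (nrmZ M y' (mcst (s - t))) => w ->; rewrite normrM [leRHS]normrM normr_id.
  lra.
apply/rn_cvgP => e e0; have e20 : 0 < e / 2 by lra.
have [c /andP[c0 _] Hc] := main _ e20.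
exists c => // t /= tc t0; rewrite sub0r normrN gtr0_norm // in tc.
apply: (@le_lt_trans _ _ (e / 2)); last by lra.
apply: L1_rn; have /Hc : 0 < t < c by rewrite t0.
move=> /(L1Z t^-1); rewrite gtr0_norm ?invr_gt0 // mulrC mulfK ?gt_eqF //.
by rewrite rscaleB // -csM mulVf ?gt_eqF // rscale1.
Qed.

(** For [s <= 1], [T(s) y'] is the limit in probability of the difference quotients of the orbit of
    [x] at [s], each bounded by the Lipschitz constant [xi]. The interval [[0, 2]] contains [s + t]
    for steps [t <= 1]. *)
Lemma mean_cont_bounded y :
  (forall x, gen_domain M Tt x ->
      forall r : R, 0 < r -> L0_lipschitz_on M (fun t => Tt t x) r) ->
  mean_cont y -> exists2 G : T -> R, measurable_fun setT G &
    forall k, {ae P, forall w, dmax k y w <= G w}.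
Proof.
move=> HL hy; have [x hx] := riem_lim hy.
have gx := generator_riem hy hx; set y' := Tt 1 y - y in gx.
have [xi [[mxi xi0] Hxi]] := HL x (ex_intro _ _ gx) 2 (ltr0n _ 2).
have Hy' s : 0 <= s <= 1 -> {ae P, forall w, nrm (Tt s y') w <= xi w}.
  move=> /andP[s0 s1].
  have /choice [t Ht] : forall n : nat, exists t, 0 < t <= 1 /\
      rn (Tt s (cs t^-1 (Tt t x - x) - y')) < half n.
    move=> n; have [c c0 Hc] := op_cont (T_op s0) (pow2V_gt0 n).
    move/rn_cvgP: gx => /(_ _ c0)[b /= b0 Hb].
    exists (Num.min (b / 2) 1); split.
      by rewrite lt_min ltr01 ge_min lexx orbT divr_gt0.
    have t0 : 0 < Num.min (b / 2) 1 by rewrite lt_min ltr01 divr_gt0.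
    apply: Hc; apply: Hb => //=; rewrite sub0r normrN gtr0_norm //.
    by rewrite gt_min; apply/orP; left; lra.
  apply: (@le_of_rho_small _ _ _ P (nrm (Tt s y')) xi
    (fun n => nrm (Tt s (cs (t n)^-1 (Tt (t n) x - x) - y')))) => //.
    move=> e e0; have [N /(_ N (leqnn N)) h] := pow2V_small e0.
    by exists N; apply: lt_trans h; have [] := Ht N.
  move=> n; have [/andP[t0 t1] _] := Ht n.
  set q := cs (t n)^-1 (Tt (t n) x - x).
  have st1 : 0 <= s + t n <= 2 by apply/andP; split; lra.
  have st2 : 0 <= s <= 2 by apply/andP; split; lra.
  have Eq : Tt s q = cs (t n)^-1 (Tt (s + t n) x - Tt s x).
    by rewrite /q (opZ (T_op s0)) // (opB (T_op s0)) T_add // ltW.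
  have Ey : Tt s y' = Tt s q - Tt s (q - y').
    by rewrite -(opB (T_op s0)) opprB addrC subrK.
  rewrite Ey; ae_with (nrmB M (Tt s q) (Tt s (q - y'))).
  rewrite Eq; ae_with (nrmZ M (Tt (s + t n) x - Tt s x) (mcst (t n)^-1)).
  ae_with (Hxi _ _ st1 st2); apply: aeW => w.
  rewrite addrAC subrr add0r (gtr0_norm t0) => h1 h2 h3; apply: (le_trans h3).
  rewrite lerD2r h2 gtr0_norm ?invr_gt0 // mulrC ler_pdivrMr //.
(* With [m = 0] the starting time is [1], so this bounds the orbit of [Tt 1 y]. *)
have [G1 mG1 HG1] := hille 0 y; rewrite expr0 in HG1.
have HG2 := bound_of_dmax mG1 HG1.
exists (fun w => `|xi w| + `|G1 w|).
  by apply: measurable_funD; apply: measurable_abs.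
move=> k; apply: dmax_ae_le => t /andP[t0 t2].
(* Up to time [1] the orbit of [y] is that of [Tt 1 y] minus that of [y']; after time [1] it is the
   orbit of [Tt 1 y], delayed. *)
have [t1|/ltW t1] := leP t 1.
  have : Tt t y = Tt t (Tt 1 y) - Tt t y' by rewrite -(opB (T_op t0)) opprB addrC subrK.
  move=> ->; ae_with (nrmB M (Tt t (Tt 1 y)) (Tt t y')).
  have t01 : 0 <= t <= 1 by rewrite t0.
  have t02 : 0 <= t <= 2 by rewrite t0.
  ae_with (Hy' t t01); ae_with (HG2 t t02); apply: aeW => w.
  have := ler_norm (xi w); have := ler_norm (G1 w); lra.
have t10 : 0 <= t - 1 by rewrite subr_ge0.
have t12 : 0 <= t - 1 <= 2 by rewrite t10 /=; lra.
have := HG2 _ t12; rewrite T_add // subrK; apply: filterS => w.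
have := ler_norm (G1 w); have := normr_ge0 (xi w); lra.
Qed.

(** * From a.s. boundedness to Lipschitz orbits *)

(** The infimum in [is_opnorm] has to be shown to be itself an admissible bound. For fixed [x] the
    quotient of [nrm (A x)] by [nrm x] is below every admissible [xi], hence below [eta]; where
    [nrm x] vanishes, [ms_opnorm] gives the vanishing of [nrm (A x)]. *)
Lemma opnorm_bound A (eta : T -> \bar R) (b : T -> R) x : rn_bounded_op M A ->
  is_opnorm M A eta -> {ae P, forall w, (eta w <= (b w)%:E)%E} ->
  {ae P, forall w, nrm (A x) w <= b w * nrm x w}.
Proof.
move=> bA [_ [_ hmax]] hb.
have [N0 [mN0 HN0 _ _ _]] := ms_opnorm (op_modsn bA).
pose g w := nrm (A x) w * `|nrm x w|^-1.
have mg : measurable_fun setT g.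
  by apply: measurable_funM => //; apply: measurable_invn.
have hg : {ae P, forall w, ((g w)%:E <= eta w)%E}.
  apply: (hmax (fun w => (g w)%:E)); first exact/measurable_EFinP.
  move=> _ [xi [[mxi xi0] [hxi ->]]].
  ae_with (hxi x); ae_with xi0; ae_with (nrm_ge0 M x); apply: aeW => w x0 xi0' h.
  rewrite lee_fin /g ger0_norm //; have [->|xn0] := eqVneq (nrm x w) 0.
    by rewrite invr0 mulr0.
  by rewrite ler_pdivrMr // lt_neqAle eq_sym xn0.
ae_with hg; ae_with hb; ae_with (HN0 x); ae_with (nrm_ge0 M x).
apply: aeW => w x0 h1 h2 h3.
have [E|xn0] := eqVneq (nrm x w) 0; first by rewrite E !mulr0 in h1 *.
have := le_trans h3 h2; rewrite lee_fin /g ger0_norm // ler_pdivrMr //.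
by rewrite lt_neqAle eq_sym xn0.
Qed.

(** By the semigroup law, [n] steps of length at most [L] cost the power [B ^+ n]. Taking [B >= 1]
    makes the powers increase with [n]. *)
Lemma as_bounded_growth r : as_bounded M Tt -> exists X : T -> R,
  [/\ measurable_fun setT X, forall w, 1 <= X w &
      forall t x, 0 <= t <= r -> {ae P, forall w, nrm (Tt t x) w <= X w * nrm x w}].
Proof.
move=> [L [L0 [N [eta [HN [[meta [hle _]] hfin]]]]]].
pose B w := 1 + `|fine (eta w)|.
have mB : measurable_fun setT B.
  apply: measurable_funD => //; apply: measurable_abs.
  exact: (measurableT_comp (@fine_measurable R setT measurableT)).
have B1 w : 1 <= B w by rewrite lerDl.
have HB t x : 0 <= t <= L -> {ae P, forall w, nrm (Tt t x) w <= B w * nrm x w}.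
  move=> htL; have [t0 tL] := andP htL; apply: (opnorm_bound x (T_op t0) (HN t htL)).
  have hNt : {ae P, forall w, (N t w <= eta w)%E}.
    by apply: hle; exists t => //=; rewrite in_itv.
  ae_with hNt; ae_with hfin; apply: aeW => w [_ /fineK E] /le_trans; apply.
  rewrite -E lee_fin /B; have := ler_norm (fine (eta w)); lra.
have HBn (n : nat) t x : 0 <= t <= n%:R * L ->
    {ae P, forall w, nrm (Tt t x) w <= B w ^+ n * nrm x w}.
  elim: n t x => [|n IH] t x /andP[t0 tn].
    have -> : t = 0 by apply/le_anti; rewrite t0 andbT -[leRHS](mul0r L).
    by apply: aeW => w; rewrite T_0 expr0 mul1r.
  have nL0 : 0 <= n%:R * L by rewrite mulr_ge0 // ltW.
  have [tn'|tn'] := leP t (n%:R * L).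
    have /IH : 0 <= t <= n%:R * L by rewrite t0.
    move=> /(_ x); apply: filter_app; ae_with (nrm_ge0 M x); apply: aeW => w x0 /le_trans.
    apply; rewrite ler_wpM2r // exprS ler_peMl // exprn_ge0 //.
    exact: le_trans (B1 w).
  have h0 : 0 <= t - n%:R * L by rewrite subr_ge0 ltW.
  have hL : 0 <= t - n%:R * L <= L.
    by rewrite h0 /= lerBlDr; apply: le_trans tn _; rewrite -nat1r mulrDl mul1r.
  have /IH : 0 <= n%:R * L <= n%:R * L by rewrite nL0 lexx.
  move=> /(_ x); apply: filter_app; have := HB _ (Tt (n%:R * L) x) hL.
  rewrite T_add // subrK; apply: filter_app; apply: aeW => w h1 h2.
  apply: (le_trans h1); rewrite exprS -mulrA ler_wpM2l //.
  exact: le_trans (B1 w).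
have [n hn] : exists n : nat, r <= n%:R * L.
  exists (Num.bound `|r / L|); rewrite -ler_pdivrMr //.
  by apply: le_trans (ler_norm _) _; apply/ltW/archi_boundP.
exists (fun w => B w ^+ n); split.
- exact: measurable_funX.
- by move=> w; apply: exprn_ege1.
- by move=> t x /andP[t0 tr]; apply: HBn; rewrite t0 (le_trans tr).
Qed.

Lemma lipschitz_of_as_bounded x r : as_bounded M Tt -> gen_domain M Tt x ->
  0 < r -> L0_lipschitz_on M (fun t => Tt t x) r.
Proof.
move=> hb [y gy] r0; have [X [mX X1 HX]] := as_bounded_growth r hb.
have X0 w : 0 < X w by apply: lt_le_trans (X1 w).
have step (n : nat) h : 0 <= h -> n%:R * h <= r ->
    {ae P, forall w, nrm (Tt (n%:R * h) x - x) w <= n%:R * (X w * nrm (Tt h x - x) w)}.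
  move=> h0; elim: n => [|n IH] hn.
    rewrite mul0r T_0 subrr; apply: filterS (nrm0 M) => w ->; by rewrite mul0r.
  have nh0 : 0 <= n%:R * h by rewrite mulr_ge0.
  have nS : n.+1%:R * h = n%:R * h + h by rewrite -natr1 mulrDl mul1r.
  have hn' : n%:R * h <= r by apply: le_trans hn; rewrite nS lerDl.
  have E : Tt (n.+1%:R * h) x - x = Tt (n%:R * h) (Tt h x - x) + (Tt (n%:R * h) x - x).
    by rewrite (opB (T_op nh0)) T_add // -nS addrA subrK.
  rewrite E; ae_with (IH hn').
  have hnr : 0 <= n%:R * h <= r by rewrite nh0.
  ae_with (HX _ (Tt h x - x) hnr); ae_with (nrmD M (Tt (n%:R * h) (Tt h x - x)) (Tt (n%:R * h) x - x)).
  apply: aeW => w a1 a2 a3; rewrite -nat1r mulrDl mul1r.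
  by apply: (le_trans a1); apply: lerD.
have speed t : 0 <= t <= r -> {ae P, forall w, nrm (Tt t x - x) w <= X w * t * nrm y w}.
  move=> /andP[]; rewrite le_eqVlt => /predU1P[<- _|t0 tr].
    by rewrite T_0 subrr; apply: filterS (nrm0 M) => w ->; rewrite mulr0 mul0r.
  pose h n := t / n.+1%:R; pose q n := cs (h n)^-1 (Tt (h n) x - x).
  have h0 n : 0 < h n by rewrite divr_gt0.
  have mXt : measurable_fun setT (fun w => X w * t) by exact: measurable_funM.
  (* Dividing by [X w * t] leaves [nrm (q n - y)] as the only error, which tends to [0] in
     probability without a random factor in front. *)
  have : {ae P, forall w, nrm (Tt t x - x) w * `|X w * t|^-1 <= nrm y w}.
    apply: (@le_of_rho_small _ _ _ P _ _ (fun n => nrm (q n - y))) => //.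
    - by apply: measurable_funM => //; apply: measurable_invn.
    - move=> e e0; move/rn_cvgP: gy => /(_ _ e0)[c /= c0 Hc].
      have [n _ /(_ n (leqnn n)) hn] := near_infty_natSinv_lt (PosNum (divr_gt0 c0 t0)).
      exists n; apply: Hc => //=; rewrite sub0r normrN gtr0_norm // /h mulrC.
      by rewrite -ltr_pdivlMr.
    - move=> n; have nh : n.+1%:R * h n = t by rewrite /h mulrC divfK // pnatr_eq0.
      have := @step n.+1 (h n) (ltW (h0 n)); rewrite nh => /(_ tr).
      apply: filter_app; ae_with (nrmZ M (Tt (h n) x - x) (mcst (h n)^-1)).
      ae_with (nrm_sub M (q n) y); apply: aeW => w a1 a2 a3.
      have Xt : 0 < X w * t by rewrite mulr_gt0.
      rewrite (gtr0_norm Xt) ler_pdivrMr //; apply: (le_trans a3).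
      have -> : n.+1%:R * (X w * nrm (Tt (h n) x - x) w) =
          nrm (q n) w * (X w * t).
        rewrite a2 gtr0_norm ?invr_gt0 // -nh.
        have := h0 n; move: (h n) (nrm _ w) (X w) (n.+1%:R : R) => a b c' m' a0.
        by field; rewrite gt_eqF.
      by rewrite ler_pM2r //; lra.
  apply: filterS => w; have Xt : 0 < X w * t by rewrite mulr_gt0.
  by rewrite (gtr0_norm Xt) ler_pdivrMr // mulrC.
(* One factor [X] comes from [speed], the other from applying [Tt t2] to the increment over
   [t1 - t2]. *)
exists (fun w => X w * X w * nrm y w); split.
  split; first by apply: measurable_funM => //; apply: measurable_funM.
  by apply: filterS (nrm_ge0 M y) => w y0; rewrite !mulr_ge0 // ltW.
have key t1 t2 : 0 <= t2 -> t2 <= t1 -> t1 <= r ->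
    {ae P, forall w, nrm (Tt t1 x - Tt t2 x) w <= X w * X w * nrm y w * (t1 - t2)}.
  move=> t20 t21 t1r; have d0 : 0 <= t1 - t2 by rewrite subr_ge0.
  have -> : Tt t1 x - Tt t2 x = Tt t2 (Tt (t1 - t2) x - x).
    by rewrite (opB (T_op t20)) T_add // (addrC t2) subrK.
  have h1 : 0 <= t1 - t2 <= r by rewrite d0 /=; lra.
  have h2 : 0 <= t2 <= r by rewrite t20 /=; lra.
  ae_with (speed _ h1); ae_with (HX _ (Tt (t1 - t2) x - x) h2); apply: aeW => w a1 a2.
  apply: (le_trans a1); rewrite -!mulrA ler_pM2l // (mulrC (nrm y w)) mulrA //.
move=> t1 t2 /andP[a1 b1] /andP[a2 b2]; have [h|/ltW h] := leP t2 t1.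
  by rewrite ger0_norm ?subr_ge0 //; apply: key.
rewrite distrC ger0_norm ?subr_ge0 //; ae_with (key _ _ a1 h b2).
have := nrmN M (Tt t2 x - Tt t1 x); rewrite opprB.
by apply: filter_app; apply: aeW => w ->.
Qed.

(** * Construction of humps *)

(** Equicontinuity on [[0, 1]] makes the increments small in probability with one [c] for all [s],
    and they are bounded by [2 * B], so [L1le_bounded] makes them small in mean. *)
Lemma mean_cont_of_bounded u (B : R) : 1 <= B ->
  (forall s, 0 <= s <= 2 -> {ae P, forall w, nrm (Tt s u) w <= B}) -> mean_cont u.
Proof.
move=> B1 hu e e0.
have B0 : 0 < 2 * B by lra.
have [c5 c50 H5] := equicont 1 (divr_gt0 e0 B0).
have [c c0 Hc] := T_cont u c50.
pose c' := Num.min (c / 2) 1; exists c'; first by rewrite lt_min ltr01 divr_gt0.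
move=> s h /andP[s0 s1] /andP[h0]; rewrite le_min => /andP[hc h1].
have hs : rn (Tt s (Tt h u - u)) < e / (2 * B).
  apply: H5; first by rewrite s0.
  by apply: Hc; rewrite h0 /=; lra.
apply: (@L1le_mono _ _ _ _ _ (2 * B * rn (Tt s (Tt h u - u)))).
  by rewrite mulrC -ler_pdivlMr // ltW.
apply: L1le_bounded => //; first by lra.
have h02 : 0 <= s + h <= 2 by apply/andP; split; lra.
have s02 : 0 <= s <= 2 by apply/andP; split; lra.
rewrite (opB (T_op s0)) T_add //; ae_with (nrmB M (Tt (s + h) u) (Tt s u)).
ae_with (hu _ h02); ae_with (hu _ s02); ae_with (nrm_ge0 M (Tt (s + h) u - Tt s u)).
by apply: aeW => w a1 a2 a3 a4; rewrite ger0_norm //; lra.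
Qed.

Lemma mean_cont0 : mean_cont 0.
Proof.
apply: (@mean_cont_of_bounded _ 1) => // s /andP[s0 _].
by rewrite (op0 (T_op s0)); apply: filterS (nrm0 M) => w ->.
Qed.

Lemma mean_contD x y : mean_cont x -> mean_cont y -> mean_cont (x + y).
Proof.
move=> hx hy e e0; have e20 : 0 < e / 2 by lra.
have [c c0 Hc] := hx _ e20; have [c' c'0 Hc'] := hy _ e20.
exists (Num.min c c'); first by rewrite lt_min c0.
move=> s h hs /andP[h0]; rewrite le_min => /andP[h1 h2].
have s0 : 0 <= s by case/andP: hs.
rewrite (opD (T_op h0)) opprD addrACA (opD (T_op s0)) (splitr e).
by apply: L1D; [apply: Hc|apply: Hc'] => //; rewrite h0.
Qed.

Lemma mean_contN x : mean_cont x -> mean_cont (- x).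
Proof.
move=> hx e e0; have [c c0 Hc] := hx _ e0; exists c => // s h hs hh.
have s0 : 0 <= s by case/andP: hs.
have h0 : 0 <= h by case/andP: hh.
by rewrite (opN (T_op h0)) -opprD (opN (T_op s0)); apply: L1N; apply: Hc.
Qed.

(* A vector of the form [1_F T(a) z] has an orbit bounded by a random variable
   [G]; dividing by [G] on [{G >= kappa}] keeps the supremum of the orbit at [1]
   on a set of fixed probability while the vector, hence its orbit in mean,
   becomes small. *)
Lemma hump q : 0 < q ->
  (forall c, 0 < c -> exists k z, in_ball M z /\ q < rho (fun w => c * dmax k z w)) ->
  forall n, exists ku : nat * S,
    [/\ forall s, 0 <= s <= 2 -> L1 (Tt s ku.2) (half n), mean_cont ku.2 &
        q / 8 <= rho (fun w => half n * dmax ku.1 ku.2 w)].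
Proof.
move=> q0 Hq n; have hn0 : 0 < half n := pow2V_gt0 n.
(* A square again: the final division by [half n] uses up one factor. *)
have [del del0 Hdel] := equicont 2 (mulr_gt0 hn0 hn0).
(* The truncated vector has norm at most [2] and [zeta] is at most the inverse of [kap], so [v] has
   norm at most [del / 2]. *)
have [kap kap0 kapE] : exists2 kap, 0 < kap & kap^-1 * 2 <= del / 2.
  by exists (4 / del); [rewrite divr_gt0|rewrite invf_div; lra].
(* With this [c], [c * G] is at most [q / 4] off the event [F] where [G >= kap]. *)
pose c := q / 4 / kap; have c0 : 0 < c by rewrite !divr_gt0.
have ckap : c * kap = q / 4 by rewrite divfK // gt_eqF.
have [k [z [hz Hz]]] := Hq _ c0.
have m0 : 0 < Num.max 1 `|c| by rewrite lt_max ltr01.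
have q40 : 0 < q / 4 by lra.
have [c3 c30 H3] := ms_cont (dmax_modsn k) (divr_gt0 q40 m0).
have c320 : 0 < c3 / 2 by lra.
have [c4 c40 H4] := T_cont z c320.
have [m /(_ m (leqnn m)) hm] := pow2V_small c40.
pose z1 := Tt (half m) z.
have hz1 : rn (z1 - z) < c3 / 2 by apply: H4; rewrite hm ltW // pow2V_gt0.
(* As [z] has norm at most [1], [z1 - z] has norm at least [1] wherever [z1] is cut off: after
   clipping, the truncation costs no more than [rn (z1 - z)]. *)
pose b w := nrm z1 w <= 2; have mb : measurable_fun setT b by exact: measurable_fun_ler.
pose i w : R := (b w)%:R; have mi : measurable_fun setT i by exact: measurable_bool_real.
pose z2 := rscale i z1.
have hz2 : {ae P, forall w, nrm z2 w <= 2}.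
  ae_with (nrmZ M z1 mi); apply: aeW => w ->; rewrite /i /b.
  by case: (leP (nrm z1 w) 2) => h /=; rewrite ?normr1 ?normr0 ?mul1r ?mul0r.
have hzz2 : rn (z - z2) < c3.
  have -> : z - z2 = (z - z1) + (z1 - z2) by rewrite addrA subrK.
  apply: le_lt_trans (rnD M _ _) _; rewrite rn_distC.
  suff : rn (z1 - z2) <= rn (z1 - z) by lra.
  have := @rho_scaled _ _ _ P 1 1 (nrm (z1 - z2)) (nrm (z1 - z)) ler01 ler01.
  rewrite !mul1r; apply => //.
  have E : z1 - z2 = rscale (fun w => 1 - i w) z1.
    rewrite (_ : (fun _ => _) = (fun w => 1 + -1 * i w)); last first.
      by apply/funext => w; rewrite mulN1r.
    rewrite rscaleDl //; last exact: measurable_funM.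
    by rewrite rscale1 rscaleA // rscaleN1.
  rewrite E; have m1i : measurable_fun setT (fun w => 1 - i w) by exact: measurable_funB.
  ae_with (nrmZ M z1 m1i); ae_with (nrm_sub M z1 z); ae_with hz.
  apply: aeW => w a1 a2 a3; rewrite !mul1r /clip a3 /i /b.
  case: (leP (nrm z1 w) 2) => h /=; first by rewrite subrr normr0 mul0r normr0 min_r // le_min ler01 /=.
  have h1 : 1 <= nrm (z1 - z) w by lra.
  rewrite [X in _ <= X]min_l ?ge_min ?lexx //.
  exact: le_trans h1 (ler_norm _).
have Hz2 : q / 2 <= rho (fun w => c * dmax k z2 w).
  have := rho_ms_tri c z z2 (dmax_modsn k).
  have := rho_mulr P c (ms_meas (dmax_modsn k) (z - z2)).
  have := H3 _ hzz2; rewrite ltr_pdivlMr // mulrC => a1 a2 a3; lra.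
have [G0 mG0 HG0] := hille m z; rewrite -/z1 in HG0.
have mz2 j : measurable_fun setT (dmax j z2) := ms_meas (dmax_modsn j) z2.
have dz2 j : {ae P, forall w, dmax j z2 w <= `|G0 w|}.
  ae_with (msZ (dmax_modsn j) z1 mi); ae_with (HG0 j); apply: aeW => w a1 ->.
  rewrite /i; case: (b w) => /=; rewrite ?normr1 ?mul1r ?normr0 ?mul0r //.
  exact: le_trans a1 (ler_norm _).
have [|||e e0|G [mG leG _ apG]] := @ae_increasing_sup _ _ _ P (fun j => dmax j z2).
- exact: mz2.
- by move=> j; apply: (ms_ge0 (dmax_modsn j)).
- by move=> j; apply: aeW => w; apply: dmaxS.
- have [a /andP[a0 _] Ha] := rho_small P mG0 e0; exists a => // j.
  have /ltW : rho (fun w => a * G0 w) < e by apply: Ha; rewrite lexx ltW.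
  apply: le_trans; apply: rho_le; try exact: measurable_funM.
  ae_with (dz2 j); ae_with (ms_ge0 (dmax_modsn j) z2); apply: aeW => w b1 b2.
  by rewrite !normrM ler_wpM2l // ger0_norm.
pose F w := kap <= G w; have mF : measurable_fun setT F by exact: measurable_fun_ler.
pose iF w : R := (F w)%:R.
have miF : measurable_fun setT iF by exact: measurable_bool_real.
pose zeta w := iF w * `|G w|^-1.
have mzeta : measurable_fun setT zeta.
  by apply: measurable_funM => //; apply: measurable_invn.
have zeta0 w : 0 <= zeta w by rewrite mulr_ge0 // /iF; case: (F w).
have zetaG w : zeta w * G w = iF w.
  rewrite /zeta /iF /F; case: (leP kap (G w)) => h /=; last by rewrite !mul0r.
  have G0' : 0 < G w by apply: lt_le_trans h.
  by rewrite mul1r (gtr0_norm G0') mulVf // gt_eqF.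
have zeta_le w : zeta w <= kap^-1.
  rewrite /zeta /iF /F; case: (leP kap (G w)) => h /=; last by rewrite mul0r invr_ge0 ltW.
  have G0' : 0 < G w by apply: lt_le_trans h.
  by rewrite mul1r (gtr0_norm G0') lef_pV2.
pose v := rscale zeta z2.
have dv j : {ae P, forall w, dmax j v w = zeta w * dmax j z2 w}.
  by ae_with (msZ (dmax_modsn j) z2 mzeta); apply: aeW => w ->; rewrite ger0_norm.
have dv1 j : {ae P, forall w, dmax j v w <= 1}.
  ae_with (dv j); ae_with (leG j); apply: aeW => w a1 ->.
  apply: (@le_trans _ _ (zeta w * G w)); first by rewrite ler_wpM2l.
  by rewrite zetaG /iF; case: (F w) => /=.
have Tv1 := bound_of_dmax (mcst 1) dv1.
have rv : rn v < del.
  apply: (@le_lt_trans _ _ (del / 2)); last by lra.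
  apply: rho_bound => //; first by lra.
  ae_with (nrmZ M z2 mzeta); ae_with hz2; ae_with (nrm_ge0 M z2).
  apply: aeW => w a1 a2 ->; rewrite ger0_norm ?mulr_ge0 // ger0_norm //.
  by apply: le_trans kapE; apply: ler_pM.
pose u := cs (half n)^-1 v.
(* Of [rho (c * G) >= q / 2], the part off [F] accounts for at most [q / 4], and replacing the
   supremum [G] by the grid of level [j] for less than [q / 8]; at least [q / 8] remains. *)
have [j hj] : exists j, q / 8 <= rho (dmax j v).
  have M0 : 0 < Num.max 1 `|kap^-1| by rewrite lt_max ltr01.
  have q80 : 0 < q / 8 by lra.
  have [j hj] := apG _ (divr_gt0 q80 M0); exists j.
  have mcG : measurable_fun setT (fun w => c * G w) by exact: measurable_funM.
  have mGj : measurable_fun setT (fun w => G w - dmax j z2 w) by exact: measurable_funB.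
  have mkGj : measurable_fun setT (fun w => kap^-1 * (G w - dmax j z2 w)).
    exact: measurable_funM.
  have h1 : q / 2 <= rho (fun w => c * G w).
    apply: (le_trans Hz2); apply: rho_le => //; first exact: measurable_funM.
    ae_with (leG k); ae_with (ms_ge0 (dmax_modsn k) z2); apply: aeW => w a1 a2.
    rewrite !normrM ler_wpM2l // !ger0_norm //; exact: le_trans a2.
  have h2 : rho (fun w => c * G w) <= rho (fun _ => q / 4) + rho iF.
    have := @rho_lin _ _ _ P 1 0 1 1 _ _ _ _ ler01 (lexx 0) ler01 ler01 mcG mcG
      (mcst (q / 4)) miF.
    rewrite !mul1r mul0r addr0; apply.
    ae_with (leG k); ae_with (ms_ge0 (dmax_modsn k) z2); apply: aeW => w a1 a2.
    rewrite !mul1r mul0r addr0; have Gw : 0 <= G w by exact: le_trans a2.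
    have [FG|FG] := boolP (F w).
      rewrite -[leLHS]add0r; apply: lerD; first exact: clip_ge0.
      by rewrite [X in _ <= X]/clip /iF FG normr1 minxx clip_le1.
    rewrite -[leLHS]addr0; apply: lerD; last exact: clip_ge0.
    have cG0 : 0 <= c * G w by rewrite mulr_ge0 // ltW.
    apply: clip_mono; rewrite (ger0_norm cG0) (gtr0_norm q40).
    by rewrite -ckap ler_pM2l //; move: FG; rewrite /F -ltNge => /ltW.
  have h3 : rho (fun _ => q / 4) <= q / 4.
    apply: rho_bound; [exact: ltW|exact: mcst|].
    by apply: aeW => ?; rewrite gtr0_norm.
  have h4 : rho iF <= rho (dmax j v) + rho (fun w => kap^-1 * (G w - dmax j z2 w)).
    apply: rho_add => //; first exact: (ms_meas (dmax_modsn j)).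
    ae_with (dv j); ae_with (leG j); apply: aeW => w a1 ->.
    have -> : iF w = zeta w * dmax j z2 w + zeta w * (G w - dmax j z2 w).
      by rewrite -mulrDr addrC subrK zetaG.
    apply: le_trans (ler_normD _ _) _; rewrite lerD2l (normrM (zeta w)) (normrM kap^-1).
    have kV0 : 0 <= kap^-1 by rewrite invr_ge0 ltW.
    by rewrite ler_wpM2r // (ger0_norm (zeta0 w)) (ger0_norm kV0) zeta_le.
  have h5 := rho_mulr P kap^-1 mGj.
  have {}hj : Num.max 1 `|kap^-1| * rho (fun w => G w - dmax j z2 w) < q / 8.
    by rewrite mulrC -ltr_pdivlMr.
  have : q / 2 <= q / 4 + (rho (dmax j v) + q / 8).
    apply: le_trans h1 (le_trans h2 _); apply: lerD h3 (le_trans h4 _).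
    by rewrite lerD2l (le_trans h5) // ltW.
  by move: (rho _) => r; lra.
have nh1 : 1 <= (half n)^-1 by rewrite invf_ge1 // pow2V_le1.
exists (j, u); split => /=.
- move=> s hs; have s0 : 0 <= s by case/andP: hs.
  rewrite /u (opZ (T_op s0)) //.
  have hsv : L1 (Tt s v) (half n * half n).
    apply: (@L1le_mono _ _ _ _ _ (1 * rn (Tt s v))).
      by rewrite mul1r ltW //; apply: Hdel.
    apply: L1le_bounded => //.
    ae_with (Tv1 s hs); ae_with (nrm_ge0 M (Tt s v)).
    by apply: aeW => w a1 a2; rewrite ger0_norm.
  by have := L1Z (half n)^-1 hsv; rewrite gtr0_norm ?invr_gt0 // mulrA mulVf ?gt_eqF // mul1r.
- apply: (mean_cont_of_bounded nh1) => s hs; have s0 : 0 <= s by case/andP: hs.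
  rewrite /u (opZ (T_op s0)) //; ae_with (nrmZ M (Tt s v) (mcst (half n)^-1)).
  ae_with (Tv1 s hs); apply: aeW => w a1 ->.
  by rewrite gtr0_norm ?invr_gt0 // ler_piMr // invr_ge0 ltW.
- apply: (le_trans hj); apply: rho_le.
  + exact: (ms_meas (dmax_modsn j)).
  + by apply: measurable_funM => //; apply: (ms_meas (dmax_modsn j)).
  ae_with (msZ (dmax_modsn j) v (mcst (half n)^-1)); apply: aeW => w ->.
  by rewrite [`|(half n)^-1|]gtr0_norm ?invr_gt0 // mulrA mulfV ?gt_eqF // mul1r.
Qed.

(** * From Lipschitz orbits to a.s. boundedness *)

Hypothesis HL : forall x, gen_domain M Tt x ->
  forall r : R, 0 < r -> L0_lipschitz_on M (fun t => Tt t x) r.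

(** Failure would feed [hump] and produce a gliding hump [y]. The tails [y - s m] are small in mean
    uniformly in time, so [y] inherits [mean_cont] from the partial sums and [mean_cont_bounded]
    applies to it. *)
Lemma dmax_bounded e : 0 < e -> exists2 c, 0 < c &
  forall k z, in_ball M z -> rho (fun w => c * dmax k z w) <= e.
Proof.
move=> q0; apply: contrapT => Hn.
have /(hump q0) /choice [ku Hku] : forall c, 0 < c -> exists k z,
    in_ball M z /\ e < rho (fun w => c * dmax k z w).
  move=> c c0; apply: contrapT => Hn'; apply: Hn; exists c => // k z hz.
  by rewrite leNgt; apply/negP => h; apply: Hn'; exists k, z.
have e80 : 0 < e / 8 by lra.
have [|||s [n_ [y [s0 sS nk sy Hy]]]] := @gliding_hump _ _ _ _ _ _ M
    (fun n => dmax (ku n).1) (fun n => (ku n).2) (e / 8) cM _ _ e80.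
- by move=> n; apply: dmax_modsn.
- move=> n; have [h _ _] := Hku n; apply: L1_rn.
  by have := h 0; rewrite T_0; apply; rewrite lexx ler0n.
- by move=> n; have [] := Hku n.
have smc m : mean_cont (s m).
  elim: m => [|m IH]; first by rewrite s0; apply: mean_cont0.
  have [_ h _] := Hku (n_ m); have [->|->] := sS m; apply: mean_contD => //.
  exact: mean_contN.
have tail r m j : 0 <= r <= 2 ->
    L1 (Tt r (s (m + j)%N - s m)) (2 * half m - 2 * half (m + j)%N).
  move=> hr; have r0 : 0 <= r by case/andP: hr.
  elim: j => [|j IH]; first by rewrite addn0 !subrr (op0 (T_op r0)); apply: L1_0.
  rewrite addnS -(subrK (s (m + j)%N) (s (m + j).+1)) -addrA (opD (T_op r0)).
  apply: (@L1le_mono _ _ _ _ _ (half (m + j) + (2 * half m - 2 * half (m + j)%N))).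
    by rewrite pow2VS; lra.
  apply: L1D => //; have [h _ _] := Hku (n_ (m + j)%N).
  have hs : L1 (Tt r (ku (n_ (m + j)%N)).2) (half (m + j)).
    by apply: L1le_mono (h _ hr); apply: pow2V_anti.
  have [->|->] := sS (m + j)%N; rewrite addrAC subrr add0r //.
  by rewrite (opN (T_op r0)); apply: L1N.
have tail_lim r m : 0 <= r <= 2 -> L1 (Tt r (y - s m)) (2 * half m).
  move=> hr; have r0 : 0 <= r by case/andP: hr.
  apply: L1_lim => a a0; have [c c0 Hc] := op_cont (T_op r0) a0.
  have [N HN] := sy _ c0; exists (Tt r (s (m + N)%N - s m)).
    apply: L1le_mono (tail r m N hr).
    by have : 0 < half (m + N) := pow2V_gt0 _; lra.
  rewrite -(opB (T_op r0)) opprB addrA subrK; apply: Hc.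
  by rewrite rn_distC; apply: HN; apply: leq_addl.
have ymc : mean_cont y.
  move=> a a0; have a160 : 0 < a / 16 by lra.
  have [m /(_ m (leqnn m)) hm] := pow2V_small a160.
  have a20 : 0 < a / 2 by lra.
  have [c c0 Hc] := smc m _ a20.
  exists (Num.min c 1); first by rewrite lt_min c0 ltr01.
  move=> r h /andP[r0 r1] /andP[h0]; rewrite le_min => /andP[hc h1].
  have rh : 0 <= r + h <= 2 by apply/andP; split; lra.
  have r2 : 0 <= r <= 2 by apply/andP; split; lra.
  have -> : Tt r (Tt h y - y) = Tt r (Tt h (s m) - s m) +
      (Tt (r + h) (y - s m) - Tt r (y - s m)).
    rewrite -(T_add (y - s m) r0 h0) -(opB (T_op r0)) -(opD (T_op r0)).
    by rewrite (opB (T_op h0)) subrACA [X in _ = Tt r X]addrC subrK.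
  apply: (@L1le_mono _ _ _ _ _ (a / 2 + (2 * half m + 2 * half m))); first by lra.
  apply: L1D; first by apply: Hc; rewrite ?r0 ?h0.
  by apply: L1B; apply: tail_lim.
have [G mG HG] := mean_cont_bounded HL ymc.
have e320 : 0 < e / 8 / 4 by lra.
(* The threshold is what [gliding_hump] guarantees for [q = e / 8]; the random bound [G] pushes
   [rho] below it for large indices. *)
have [c /andP[c0 _] Hc] := rho_small P mG e320.
have [N /(_ (n_ N) (nk N)) hN] := pow2V_small c0.
have hn0 : 0 < half (n_ N) := pow2V_gt0 _.
have /Hc : 0 <= half (n_ N) <= c by rewrite !ltW.
rewrite ltNge => /negP; apply; apply: le_trans (Hy N) _.
apply: rho_le; [|exact: measurable_funM|].
  by apply: measurable_funM => //; apply: (ms_meas (dmax_modsn _)).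
ae_with (HG (ku (n_ N)).1); ae_with (ms_ge0 (dmax_modsn (ku (n_ N)).1) y).
apply: aeW => w a1 a2; rewrite !normrM ler_wpM2l // (ger0_norm a1).
exact: le_trans a2 (ler_norm _).
Qed.

(** The norms [Nk] of the seminorms [dmax k] increase and are bounded in probability by
    [dmax_bounded]. Their supremum [G] dominates all operators on [[0, 2]], the interval covered by
    the grids, whence the witness [2]. *)
Lemma as_bounded_of_lipschitz : as_bounded M Tt.
Proof.
have /choice [Nk HNk] := fun k => ms_opnorm (dmax_modsn k).
have [|||e e0|G [mG leG minG _]] := @ae_increasing_sup _ _ _ P Nk.
- by move=> k; have [] := HNk k.
- by move=> k; have [] := HNk k.
- move=> k; have [_ _ Hmin _ _] := HNk k; have [mN' HN' _ _ N'0] := HNk k.+1.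
  apply: Hmin => // x hx; ae_with (HN' x); ae_with hx; ae_with N'0.
  apply: aeW => w a1 a2 a3; apply: le_trans (dmaxS _ _ _) (le_trans a3 _).
  by rewrite ler_piMr.
- have [c c0 Hc] := dmax_bounded e0; exists c => // k.
  by have [_ _ _ h _] := HNk k; apply: h => x; apply: Hc.
have G0 : {ae P, forall w, 0 <= G w}.
  have [_ _ _ _ h] := HNk 0%N; ae_with h; ae_with (leG 0%N).
  by apply: aeW => w h2 h1; apply: le_trans h2.
have HG t x : 0 <= t <= 2 -> {ae P, forall w, nrm (Tt t x) w <= G w * nrm x w}.
  apply: bound_of_dmax; first exact: measurable_funM.
  move=> k; have [_ h _ _ _] := HNk k; ae_with (h x); ae_with (leG k).
  ae_with (nrm_ge0 M x); apply: aeW => w x0 a1 a2; apply: (le_trans a2).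
  by rewrite ler_wpM2r.
have [N HN] := norm_family.
have N_le t (H : T -> R) : 0 <= t -> measurable_fun setT H ->
    {ae P, forall w, 0 <= H w} ->
    (forall x, {ae P, forall w, nrm (Tt t x) w <= H w * nrm x w}) ->
    {ae P, forall w, N t w <= H w}.
  move=> t0 mH H0 Hx; have [_ _ h _ _] := HN t t0; apply: h => // x hx.
  ae_with (Hx x); ae_with hx; ae_with H0; apply: aeW => w a1 a2 a3.
  by apply: (le_trans a3); rewrite ler_piMr.
exists 2; split => //; exists (fun t w => (N t w)%:E), (fun w => (G w)%:E); split.
  move=> t /andP[t0 t2]; have [mN Nx _ _ N0] := HN t t0; split.
    exact/measurable_EFinP.
  split.
    move=> _ [xi [[mxi xi0] [hxi ->]]].
    by ae_with (N_le t xi t0 mxi xi0 hxi); apply: aeW => w; rewrite lee_fin.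
  by move=> eta' _; apply; exists (N t).
split; last by ae_with G0; apply: aeW => w; rewrite lee_fin.
split; first exact/measurable_EFinP.
split.
  move=> zeta [t /=]; rewrite in_itv /= => /andP[t0 t2] <-.
  have /HG Gt : 0 <= t <= 2 by rewrite t0.
  by ae_with (N_le t G t0 mG G0 Gt); apply: aeW => w; rewrite lee_fin.
move=> eta' meta' Heta'.
have N_eta t : 0 <= t <= 2 -> {ae P, forall w, ((N t w)%:E <= eta' w)%E}.
  by move=> ht; apply: Heta'; exists t => //=; rewrite in_itv.
(* the least upper bound property of [G] is about real-valued functions *)
pose H w := fine (mine (eta' w) (G w)%:E).
have mH : measurable_fun setT H.
  apply: (measurableT_comp (@fine_measurable R setT measurableT)).
  by apply: measurable_mine => //; apply/measurable_EFinP.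
have HE (a : R) w : (a%:E <= eta' w)%E -> a <= G w ->
    a <= H w /\ ((H w)%:E <= eta' w)%E.
  move=> h1 h2; have h : (a%:E <= mine (eta' w) (G w)%:E)%E.
    by rewrite le_min h1 lee_fin.
  have fn : mine (eta' w) (G w)%:E \is a fin_num.
    rewrite fin_real //; apply/andP; split; first exact: lt_le_trans (ltNyr a) h.
    by apply: le_lt_trans (ltry (G w)); rewrite ge_min lexx orbT.
  by rewrite -lee_fin /H fineK // h ge_min lexx.
have GH : {ae P, forall w, G w <= H w}.
  apply: minG => // k; have [_ _ h _ _] := HNk k; apply: h => // x hx.
  apply: dmax_ae_le => t ht; have t0 : 0 <= t by case/andP: ht.
  have [_ Nx _ _ N0] := HN t t0; ae_with (Nx x); ae_with N0; ae_with hx.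
  ae_with (N_eta t ht); ae_with (N_le t G t0 mG G0 (fun x => HG t x ht)).
  apply: aeW => w a1 a2 a3 a4 a5; apply: le_trans (HE _ w a2 a1).1.
  by apply: (le_trans a5); rewrite ler_piMr.
(* A finite lower bound of [eta'] keeps the minimum with [G] away from [-oo], where [fine] would
   return its default [0]; the norm at time [0] serves. *)
have N0_eta : {ae P, forall w, ((N 0 w)%:E <= eta' w)%E}.
  by apply: N_eta; rewrite lexx ler0n.
have N0_G : {ae P, forall w, N 0 w <= G w}.
  by apply: N_le => // x; apply: HG; rewrite lexx ler0n.
ae_with GH; ae_with N0_eta; ae_with N0_G; apply: aeW => w a1 a2 a3.
by apply: le_trans (HE _ w a2 a1).2; rewrite lee_fin.
Qed.

End Semigroup.

Theorem theorem3p11 (d : measure_display) (T : measurableType d) (R : realType)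
    (P : probability T R) (isC : bool) (S : zmodType) (M : RNModule P isC S)
    (Tt : R -> S -> S) :
  rn_complete M ->
  C0_semigroup M Tt ->
  (as_bounded M Tt <->
   (forall x, gen_domain M Tt x ->
      forall r : R, 0 < r -> L0_lipschitz_on M (fun t => Tt t x) r)).
Proof.
move=> cM hT; split=> [hb x hx r r0|HL].
  exact: (lipschitz_of_as_bounded hT).
exact: (as_bounded_of_lipschitz cM hT HL).
Qed.
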